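(* Let $(\mathcal{Y},T,\nu)$, $(\mathcal{X},S)$ and $\ell:\mathcal{X}\times\mathcal{Y}\to\mathbb{R}$ satisfy the standard assumptions. Then the set of optimal joinings $$\mathcal{J}_{\min}(S:\nu)=\Big\{\lambda\in\mathcal{J}(S:\nu):\int\ell\,d\lambda=L(S:\nu)\Big\}$$ is non-empty, convex, and compact in the weak topology. Furthermore, a joining $\lambda \in \mathcal{J}_{\min}(S:\nu)$ is an extreme point of $\mathcal{J}_{\min}(S:\nu)$ if and only if it is ergodic under $S\times T$.
   Context: Standard assumptions: (i) $\mathcal{Y}$ is a non-empty Polish space, $T:\mathcal{Y}\to\mathcal{Y}$ is Borel measurable, and $\nu$ is a Borel probability measure on $\mathcal{Y}$ that is invariant and ergodic under $T$; (ii) $\mathcal{X}$ is a non-empty compact metric space and $S:\mathcal{X}\to\mathcal{X}$ is continuous; (iii) $\ell:\mathcal{X}\times\mathcal{Y}\to\mathbb{R}$ is lower semicontinuous and there is $\ell^*\in L^1(\nu)$ with $\sup_{x\in\mathcal{X}}|\ell(x,y)|\le \ell^*(y)$ for all $y\in\mathcal{Y}$. $S\times T$ is the map $(x,y)\mapsto(Sx,Ty)$ on $\mathcal{X}\times\mathcal{Y}$. $\mathcal{J}(S:\nu)$ is the set of all Borel probability measures on $\mathcal{X}\times\mathcal{Y}$ that are invariant under $S\times T$ and whose $\mathcal{Y}$-marginal is $\nu$, and $L(S:\nu)=\inf_{\lambda\in\mathcal{J}(S:\nu)}\int\ell\,d\lambda$. The weak topology is that of weak convergence of Borel probability measures on $\mathcal{X}\times\mathcal{Y}$.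 A measure $\mu$ is an extreme point of a convex family $\mathcal{M}$ of probability measures if $\mu \in \mathcal{M}$ and $\mu=t\mu_1+(1-t)\mu_2$ with $t\in(0,1)$ and $\mu_1,\mu_2\in\mathcal{M}$ implies $\mu_1=\mu_2=\mu$. *)

(* Defs.v *)
From HB Require Import structures.
From mathcomp Require Import all_boot all_order all_algebra.
From mathcomp Require Import all_classical all_reals all_analysis.
Set Implicit Arguments.
Unset Strict Implicit.
Unset Printing Implicit Defensive.
Import Order.TTheory GRing.Theory Num.Theory.
Import numFieldNormedType.Exports.
Local Open Scope classical_set_scope.
Local Open Scope ring_scope.

#[short(type="pmetricType")]
HB.structure Definition PointedMetric (K : numDomainType) :=
  {M of Metric K M & isPointed M}.

#[short(type="completeMetricType")]
HB.structure Definition CompleteMetric (K : numDomainType) :=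
  {M of Metric K M & Complete M}.

Definition polish_space (R : realType) (Y : topologicalType) : Prop :=
  (exists2 D : set Y, countable D & dense D) /\
  exists (M : completeMetricType R) (f : Y -> M) (g : M -> Y),
    [/\ cancel f g, cancel g f, continuous f & continuous g].

Notation borel T := (g_sigma_algebraType (@open T)).

Section mixture.
Local Open Scope ereal_scope.
Context d (T : measurableType d) (R : realType).
Variables (t : {i01 R}) (mu1 mu2 : probability T R).

Definition mixture : set T -> \bar R :=
  measure_add (mscale t%:num%:nng%R mu1) (mscale (1 - t%:num)%:nng%R mu2).

HB.instance Definition _ := Measure.on mixture.

Let mixture_setT : mixture setT = 1.
Proof.
rewrite /mixture measure_addE/= /mscale/= !probability_setT !mule1 -EFinD.
by rewrite addrC subrK.
Qed.

HB.instance Definition _ :=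
  Measure_isProbability.Build _ _ _ mixture mixture_setT.

End mixture.

Section measure_families.
Context d (T : measurableType d) (R : realType).
Implicit Types (mu : probability T R) (M : set (probability T R)).

(* A [probability T R] is a function on all subsets of [T], unconstrained
   (apart from its sign) outside the sigma-algebra, so Leibniz equality is
   too fine: measures are identified when they agree on measurable sets. *)
Definition same_measure mu mu' := forall A, measurable A -> mu A = mu' A.

Definition convex_family M := forall (t : {i01 R}) mu1 mu2,
  M mu1 -> M mu2 -> M (mixture t mu1 mu2).

Definition extreme_point M mu := M mu /\
  forall (t : {i01 R}) mu1 mu2, 0 < t%:num < 1 -> M mu1 -> M mu2 ->
    same_measure mu (mixture t mu1 mu2) ->
    same_measure mu1 mu /\ same_measure mu2 mu.

Definition invariant mu (F : T -> T) :=
  forall A, measurable A -> pushforward mu F A = mu A.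

Definition ergodic mu (F : T -> T) := invariant mu F /\
  forall A, measurable A -> F @^-1` A = A -> mu A = 0%E \/ mu A = 1%E.

End measure_families.

HB.instance Definition _ (X Y : ptopologicalType) :=
  Pointed.on (X * Y)%type.

Section weak_convergence.
Context (R : realType) (Z : ptopologicalType).

Definition bounded_continuous :=
  {f : Z -> R | continuous f /\ bounded_fun f}.

Definition integrals (mu : probability (borel Z) R) :
    {ptws bounded_continuous -> R} :=
  fun f => (\int[mu]_z sval f z)%R.

(* The coarsest topology making [mu |-> \int[mu]_z f z] continuous for every
   bounded continuous [f]. *)
Definition weak_probability : topologicalType := initial_topology integrals.

End weak_convergence.

Definition prod_map (A B A' B' : Type) (f : A -> A') (g : B -> B') :
  A * B -> A' * B' := fun z => (f z.1, g z.2).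

Section joinings.
Context (R : realType) (X Y : ptopologicalType).
Variables (S : X -> X) (T : Y -> Y) (nu : probability (borel Y) R).
Variable ell : X * Y -> R.

Definition joinings : set (probability (borel (X * Y)%type) R) :=
  [set la : probability (borel (X * Y)%type) R |
    invariant la (prod_map S T) /\
    forall B : set (borel Y), measurable B ->
      pushforward la (snd : borel (X * Y)%type -> borel Y) B = nu B].

Definition min_cost : \bar R :=
  ereal_inf [set (\int[la]_z (ell z)%:E)%E | la in joinings].

Definition optimal_joinings : set (probability (borel (X * Y)%type) R) :=
  [set la | joinings la /\ (\int[la]_z (ell z)%:E)%E = min_cost].

End joinings.

(* Main.v *)
Require Import Defs.
From HB Require Import structures.
From mathcomp Require Import all_boot all_order all_algebra.
From mathcomp Require Import all_classical all_reals all_analysis.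
From mathcomp Require Import measurable_realfun lra.
Set Implicit Arguments.
Unset Strict Implicit.
Unset Printing Implicit Defensive.
Import Order.TTheory GRing.Theory Num.Theory.
Import numFieldNormedType.Exports.
Local Open Scope classical_set_scope.
Local Open Scope ring_scope.

(** A probability measure on [X * Y] with marginal [nu] is tested on the
    integrands: the bounded Borel functions of [(x, y)] that are continuous in
    [x] alone. They include the bounded continuous functions and the bounded
    Borel functions of [y], and they are stable under composition with
    [prod_map S T] although [T] is only Borel.

    Take a positive normalised linear functional on the integrands that agrees
    with [nu] on the indicators of Borel sets of [y]. It is automatically
    smooth along sequences decreasing to 0: for each [y], Dini's theorem on the
    compact space [X] makes the convergence uniform in [x], and the
    sigma-additivity of [nu] controls the exceptional [y]
    ([joining_functional_smooth]). By the Daniell--Stone theorem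
    ([daniell_stone]) it is the integral of a measure, with marginal [nu]
    ([joining_functional_measure]). This takes the place of tightness.

    Such functionals are stable under limits along ultrafilters, and so is their
    invariance under [prod_map S T]. Hence an ultrafilter of joinings converges
    to a joining against every integrand, in particular weakly
    ([joinings_ultralimit]), and an ultralimit of Cesaro means provides a joining
    to begin with ([joinings_nonempty]). The function [ell + ellstar] is an
    increasing limit of nonnegative integrands ([excess_approximation]), so the
    cost is lower semicontinuous along these limits
    ([cost_lower_semicontinuous]): the minimum is attained, and an ultrafilter of
    optimal joinings converges to an optimal joining.

    For the extreme points, the key is that an invariant probability measure
    dominated by an ergodic one equals it ([ergodic_unique]). The components of
    a decomposition of an ergodic [la] are dominated by [la], so they are equal
    to [la]. Conversely, if an invariant set has intermediate [la]-measure, then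
    the marginals of the two conditional measures of [la] are invariant and
    dominated by the ergodic measure [nu], so they are equal to [nu]: the
    conditional measures are joinings. Their costs average to the minimum, so
    both are optimal, and [la] is not extreme. *)

(** * Daniell--Stone representation *)

Section ramp.
Context (T : Type) (R : realType).
Implicit Types f : T -> R.

(** For [f >= 0], an approximation from below of the indicator of [f > 0] that
    is exact at each point for [m] large enough. *)
Definition ramp f (m : nat) : T -> R := (cst 1) \min (cst m%:R \* f).

Variable f : T -> R.
Hypothesis f0 : forall x, 0 <= f x.

Lemma ramp_ge0 m x : 0 <= ramp f m x.
Proof. by rewrite /ramp/= le_min ler01 mulr_ge0. Qed.

Lemma ramp_le1 m x : ramp f m x <= 1.
Proof. by rewrite /ramp/= ge_min lexx. Qed.

Lemma ramp_leS m x : ramp f m x <= ramp f m.+1 x.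
Proof.
rewrite /ramp/= le_min ge_min lexx/= ge_min; apply/orP; right.
by rewrite ler_wpM2r// ler_nat.
Qed.

Lemma ramp0 m x : f x = 0 -> ramp f m x = 0.
Proof. by move=> fx; rewrite /ramp/= fx mulr0 min_r. Qed.

Lemma ramp1 x : 0 < f x -> exists n, forall m, (n <= m)%N -> ramp f m x = 1.
Proof.
move=> fx; exists (Num.truncn (f x)^-1).+1 => m nm; rewrite /ramp/= min_l//.
rewrite -ler_pdivrMr// mul1r.
have /ltW/le_trans := truncnS_gt (f x)^-1; apply.
by rewrite ler_nat.
Qed.

End ramp.

Section daniell.
Context d (T : measurableType d) (R : realType).
Implicit Types (E : set (T -> R)) (I : (T -> R) -> R) (f g : T -> R).

Record lattice_algebra E : Prop := LatticeAlgebra {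
  algebra_cst : forall c, E (cst c);
  algebraD : forall f g, E f -> E g -> E (f \+ g);
  algebraM : forall f g, E f -> E g -> E (f \* g);
  algebra_min : forall f g, E f -> E g -> E (f \min g);
  algebra_bounded : forall f, E f -> exists M : R, forall x, `|f x| <= M }.

Record mean E I : Prop := Mean {
  mean1 : I (cst 1) = 1;
  meanD : forall f g, E f -> E g -> I (f \+ g) = I f + I g;
  meanZ : forall c f, E f -> I (cst c \* f) = c * I f;
  mean_ge0 : forall f, E f -> (forall x, 0 <= f x) -> 0 <= I f }.

Definition sigma_smooth E I := forall f : nat -> T -> R,
  (forall n, E (f n)) -> (forall n x, 0 <= f n x) ->
  (forall n x, f n.+1 x <= f n x) ->
  (forall x (e : R), 0 < e -> exists n, f n x <= e) ->
  forall e : R, 0 < e -> exists n, I (f n) <= e.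

(** Covers are increasing sequences that reach 1 at each point after finitely
    many steps. Such sequences can be multiplied by ramps and truncated, and the
    [n]-th partial sums of the [n]-th terms cover a countable union. *)
Definition coverable E I (A : set T) (c : R) := exists h : nat -> T -> R,
  [/\ forall n, E (h n), forall n x, 0 <= h n x,
      forall n x, h n x <= h n.+1 x, forall n, I (h n) <= c &
      forall x, A x -> exists n, 1 <= h n x].

Definition outer_mean E I (A : set T) : \bar R :=
  ereal_inf [set c%:E | c in coverable E I A].

Section theory.
Variables (E : set (T -> R)) (I : (T -> R) -> R).
Hypotheses (algE : lattice_algebra E) (meanI : mean E I)
  (smoothI : sigma_smooth E I).

Lemma algebraZ c f : E f -> E (cst c \* f).
Proof. by move=> Ef; apply: algebraM => //; exact: algebra_cst. Qed.

Lemma algebraB f g : E f -> E g -> E (f \- g).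
Proof.
move=> Ef Eg; have -> : f \- g = f \+ (cst (-1) \* g).
  by apply/funext => x /=; rewrite mulN1r.
by apply: algebraD => //; exact: algebraZ.
Qed.

Lemma meanB f g : E f -> E g -> I (f \- g) = I f - I g.
Proof.
move=> Ef Eg; have -> : f \- g = f \+ (cst (-1) \* g).
  by apply/funext => x /=; rewrite mulN1r.
by rewrite (meanD meanI) ?(meanZ meanI) ?mulN1r//; exact: algebraZ.
Qed.

Lemma mean_le f g : E f -> E g -> (forall x, f x <= g x) -> I f <= I g.
Proof.
move=> Ef Eg fg; rewrite -subr_ge0 -meanB//; apply: (mean_ge0 meanI).
  exact: algebraB.
by move=> x /=; rewrite subr_ge0.
Qed.

Lemma mean_cst c : I (cst c) = c.
Proof.
have -> : cst c = cst c \* cst 1 :> (T -> R) by apply/funext => x /=; rewrite mulr1.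
by rewrite (meanZ meanI) ?(mean1 meanI) ?mulr1//; exact: algebra_cst.
Qed.

Lemma algebra_sum (h : nat -> T -> R) n : (forall k, E (h k)) ->
  E (fun x => \sum_(k < n) h k x).
Proof.
move=> Eh; elim: n => [|n IH].
  by under eq_fun do rewrite big_ord0; exact: algebra_cst.
under eq_fun do rewrite big_ord_recr/=; exact: algebraD.
Qed.

Lemma mean_sum (h : nat -> T -> R) n : (forall k, E (h k)) ->
  I (fun x => \sum_(k < n) h k x) = \sum_(k < n) I (h k).
Proof.
move=> Eh; elim: n => [|n IH].
  by under eq_fun do rewrite big_ord0; rewrite big_ord0 mean_cst.
under eq_fun do rewrite big_ord_recr/=; rewrite big_ord_recr/= -IH.
by rewrite -(meanD meanI)//; exact: algebra_sum.
Qed.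

Lemma homo_seq (h : nat -> T -> R) x : (forall n x, h n x <= h n.+1 x) ->
  {homo h ^~ x : m n / (m <= n)%N >-> m <= n}.
Proof.
move=> hS; apply: homo_leq => [//|y u v|i]; [exact: le_trans | exact: hS].
Qed.

Lemma coverable_ge0 A c : coverable E I A c -> 0 <= c.
Proof.
move=> [h [Eh h0 _ hc _]]; apply: le_trans (hc 0%N).
exact: (mean_ge0 meanI).
Qed.

Lemma outer_mean_le A c : coverable E I A c -> (outer_mean E I A <= c%:E)%E.
Proof. by move=> Ac; apply: ereal_inf_lbound; exists c. Qed.

Lemma outer_mean_ge A c : (forall c', coverable E I A c' -> c <= c') ->
  (c%:E <= outer_mean E I A)%E.
Proof.
by move=> H; apply: le_ereal_inf_tmp => _ [c' /H ? <-]; rewrite lee_fin.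
Qed.

Lemma outer_mean_ge0 A : (0 <= outer_mean E I A)%E.
Proof. by apply: outer_mean_ge => c; exact: coverable_ge0. Qed.

Lemma coverable1 A : coverable E I A 1.
Proof.
exists (fun=> cst 1); split => //.
- by move=> _; exact: algebra_cst.
- by move=> n; rewrite (mean1 meanI).
- by move=> x _; exists 0%N.
Qed.

Lemma outer_mean_fin_num A : outer_mean E I A \is a fin_num.
Proof.
rewrite ge0_fin_numE ?outer_mean_ge0//.
by rewrite (le_lt_trans (outer_mean_le (coverable1 A)))// ltry.
Qed.

Lemma outer_mean_adherent A e : 0 < e ->
  exists2 c, coverable E I A c & (c%:E <= outer_mean E I A + e%:E)%E.
Proof.
move=> e0; have [_ [c Ac <-] /ltW ?] :=
  lb_ereal_inf_adherent e0 (outer_mean_fin_num A).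
by exists c.
Qed.

Lemma outer_mean0 : outer_mean E I set0 = 0.
Proof.
apply/eqP; rewrite eq_le outer_mean_ge0 andbT; apply: outer_mean_le.
exists (fun=> cst 0); split => //.
- by move=> _; exact: algebra_cst.
- by move=> n; rewrite mean_cst.
Qed.

Lemma le_outer_mean : {homo outer_mean E I : A B / A `<=` B >-> (A <= B)%E}.
Proof.
move=> A B AB; apply: le_ereal_inf_tmp => _ [c [h [Eh h0 hS hc hB]] <-].
by apply: outer_mean_le; exists h; split => // x /AB; exact: hB.
Qed.

(** If [h k] covers [A k] for all [k], then the sums over [k < n] of the
    [h k n] cover the union of the [A k]. *)
Lemma outer_mean_sigma_subadditive : sigma_subadditive (outer_mean E I).
Proof.
move=> A.
suff add2e (e : {posnum R}) :
    (outer_mean E I (\bigcup_n A n) <=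
      \sum_(i <oo) outer_mean E I (A i) + e%:num%:E)%E.
  by apply/lee_addgt0Pr => _/posnumP[].
rewrite (le_trans _ (epsilon_trick _ _ _))//; last first.
  by move=> n; exact: outer_mean_ge0.
have /choice[c Pc] : forall n, exists c, coverable E I (A n) c /\
    (c%:E <= outer_mean E I (A n) + (e%:num / (2 ^ n.+1)%:R)%:E)%E.
  move=> n; have [|c ? ?] := @outer_mean_adherent (A n) (e%:num / (2 ^ n.+1)%:R).
    by [].
  by exists c.
have /choice[h Ph] := fun n => (Pc n).1.
apply: (@le_trans _ _ (\sum_(i <oo) (c i)%:E)%E); last first.
  apply: lee_nneseries => [i _ _|i _]; last exact: (Pc i).2.
  by rewrite lee_fin; exact: coverable_ge0 (Pc i).1.
have c0 i : 0 <= c i by exact: coverable_ge0 (Pc i).1.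
have : (0 <= \sum_(i <oo) (c i)%:E)%E.
  by apply: nneseries_ge0 => i _ _; rewrite lee_fin.
case E1 : (\sum_(i <oo) (c i)%:E)%E => [s| |//] s0; last by rewrite leey.
apply: outer_mean_le.
pose H n x := \sum_(k < n) h k n x.
have h1 k n x : h k n x <= h k n.+1 x by case: (Ph k).
have Eh k n : E (h k n) by case: (Ph k).
have h0 k n x : 0 <= h k n x by case: (Ph k).
have Ih k n : I (h k n) <= c k by case: (Ph k).
exists H; split.
- by move=> n; exact: (algebra_sum (h := fun k => h k n)).
- by move=> n x; apply: sumr_ge0.
- move=> n x; rewrite /H big_ord_recr/= ler_wpDr//.
  by apply: ler_sum => i _.
- move=> n; rewrite (mean_sum (h := fun k => h k n))// -lee_fin -E1.
  apply: (@le_trans _ _ (\sum_(0 <= i < n) (c i)%:E)%E).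
    by rewrite big_mkord sumEFin lee_fin; exact: ler_sum.
  by apply: nneseries_lim_ge => i _ _; rewrite lee_fin.
- move=> x [k _ Akx].
  have [n hn] : exists n, 1 <= h k n x by case: (Ph k) => _ _ _ _; exact.
  exists (maxn n k.+1); rewrite /H.
  have km : (k < maxn n k.+1)%N by rewrite leq_max ltnS leqnn orbT.
  rewrite (bigD1 (Ordinal km))//= ler_wpDr ?sumr_ge0//.
  rewrite (le_trans hn)//; apply: (homo_seq x (h1 k)).
  by rewrite leq_max leqnn.
Qed.

Lemma algebra_ramp f m : E f -> E (ramp f m).
Proof.
by move=> Ef; apply: algebra_min => //; [exact: algebra_cst | exact: algebraZ].
Qed.

(** A positive level set is Caratheodory-measurable: a cover [h] of [A] splits
    into the covers [h n * ramp f n] of the inside and [h n * (1 - ramp f m)]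
    of the outside, and for large [m] the total cost exceeds the cost of [h]
    by as little as wanted. *)
Lemma caratheodory_level_set f : E f -> (forall x, 0 <= f x) ->
  forall A, (outer_mean E I (A `&` [set x | (0 < f x)%R]) +
    outer_mean E I (A `&` ~` [set x | (0 < f x)%R]) <= outer_mean E I A)%E.
Proof.
move=> Ef f0 A; apply: le_ereal_inf_tmp => _ [c [h [Eh h0 hS hc hA]] <-].
pose H n := h n \* ramp f n.
have EH n : E (H n) by apply: algebraM => //; exact: algebra_ramp.
have r0 := ramp_ge0 f0.
have EG n m : E (h n \* (cst 1 \- ramp f m)).
  apply: algebraM => //; apply: algebraB; first exact: algebra_cst.
  exact: algebra_ramp.
have Hh n x : H n x <= h n x by rewrite /= ler_piMr// ramp_le1.
have HS n x : H n x <= H n.+1 x by apply: ler_pM => //; exact: ramp_leS.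
pose S := [set I (H n) | n in [set: nat]].
have ubS : ubound S c.
  by move=> _ [n _ <-]; rewrite (le_trans _ (hc n))// mean_le.
have supS : has_sup S by split; [exists (I (H 0%N)); exists 0%N | exists c].
pose a := sup S.
have Ha n : I (H n) <= a by apply: ub_le_sup; [exists c | exists n].
have inside : (outer_mean E I (A `&` [set x | (0 < f x)%R]) <= a%:E)%E.
  apply: outer_mean_le; exists H; split => //.
    by move=> n x; rewrite mulr_ge0.
  move=> x [/hA[n hn] /= fx]; have [m hm] := ramp1 fx; exists (maxn n m).
  rewrite /H/= hm ?leq_maxr// mulr1 (le_trans hn)//.
  by apply: (homo_seq x hS); exact: leq_maxl.
apply/lee_addgt0Pr => e e0.
have [_ [m _ <-] am] := sup_adherent e0 supS.
apply: le_trans (leeD inside _) _.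
- apply: (outer_mean_le (c := c - a + e)).
  have cost n : (m <= n)%N -> I (h n \* (cst 1 \- ramp f m)) <= c - a + e.
    move=> mn; have -> : h n \* (cst 1 \- ramp f m) = h n \- (h n \* ramp f m).
      by apply/funext => x /=; rewrite mulrBr mulr1.
    rewrite meanB//; last by apply: algebraM => //; exact: algebra_ramp.
    have : I (H m) <= I (h n \* ramp f m).
      apply: mean_le => //; first by apply: algebraM => //; exact: algebra_ramp.
      move=> x; rewrite /H/= ler_wpM2r//.
      exact: (homo_seq x hS).
    move: (hc n) am; rewrite -/a; lra.
  have G0 n x : 0 <= (h n \* (cst 1 \- ramp f m)) x.
    by rewrite /= mulr_ge0// subr_ge0 ramp_le1.
  have GS n x :
      (h n \* (cst 1 \- ramp f m)) x <= (h n.+1 \* (cst 1 \- ramp f m)) x.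
    by rewrite /= ler_wpM2r// subr_ge0 ramp_le1.
  exists (fun n => h n \* (cst 1 \- ramp f m)); split => //.
    move=> n; apply: le_trans (cost (maxn m n) (leq_maxl _ _)).
    apply: mean_le => // x.
    apply: (homo_seq (h := fun n => h n \* (cst 1 \- ramp f m)) x GS).
    exact: leq_maxr.
  move=> x [/hA[n hn] /= /negP]; rewrite -leNgt => fx; exists n.
  rewrite ramp0 ?subr0 ?mulr1//.
  by apply/eqP; rewrite eq_le fx f0.
- rewrite -!EFinD lee_fin; lra.
Qed.

(** Along a cover [h] of [g > 0], the differences [g - min g (h n)] vanish
    eventually at each point, so that their means tend to 0. *)
Lemma mean_le_outer g : E g -> (forall x, 0 <= g x <= 1) ->
  ((I g)%:E <= outer_mean E I [set x | (0 < g x)%R])%E.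
Proof.
move=> Eg g01; have g0 x : 0 <= g x by case/andP: (g01 x).
have g1 x : g x <= 1 by case/andP: (g01 x).
apply: outer_mean_ge => c [h [Eh h0 hS hc hA]].
pose u n := g \- (g \min h n).
have Em n : E (g \min h n) by exact: algebra_min.
apply/ler_addgt0Pr => e e0.
have [||||n In] := smoothI (f := u) _ _ _ _ e0.
- by move=> n; exact: algebraB.
- by move=> n x; rewrite /u/= subr_ge0 ge_min lexx.
- move=> n x; rewrite /u/= lerD2l lerN2 le_min !ge_min lexx/=.
  by rewrite hS orbT.
- move=> x e' e'0; have [gx|gx] := ltP 0 (g x).
    have [n hn] := hA x gx; exists n; rewrite /u/= min_l ?subrr ?(ltW e'0)//.
    exact: le_trans (g1 x) hn.
  exists 0%N; rewrite /u/= min_l ?subrr ?(ltW e'0)//.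
  exact: le_trans gx (h0 _ _).
- move: In; rewrite /u meanB//.
  have : I (g \min h n) <= I (h n).
    by apply: mean_le => // x; rewrite /= ge_min lexx orbT.
  move: (hc n); lra.
Qed.

End theory.
End daniell.

Section bounded_integral.
Context d (T : measurableType d) (R : realType) (mu : probability T R).

Lemma bounded_integrable (f : T -> R) (M : R) : measurable_fun setT f ->
  (forall x, `|f x| <= M) -> mu.-integrable setT (EFin \o f).
Proof.
move=> mf fM; apply: measurable_bounded_integrable => //.
  by rewrite [X in (X < _)%E]probability_setT ltry.
exists M; split; first exact: num_real.
by move=> c Mc x _ /=; exact: le_trans (fM x) (ltW Mc).
Qed.

Lemma mean_Rintegral (E : set (T -> R)) : lattice_algebra E ->
  (forall f, E f -> measurable_fun setT f) ->
  mean E (fun f => \int[mu]_x f x).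
Proof.
move=> algE mE.
have intE f : E f -> mu.-integrable setT (EFin \o f).
  move=> Ef; have [M fM] := algebra_bounded algE Ef.
  by apply: bounded_integrable fM; exact: mE.
split.
- by rewrite Rintegral_cst// [X in fine X]probability_setT mul1r.
- by move=> f g Ef Eg; apply: RintegralD => //; exact: intE.
- by move=> c f Ef; apply: RintegralZl => //; exact: intE.
- by move=> f Ef f0; apply: Rintegral_ge0.
Qed.

End bounded_integral.

Section layers.
Context (R : realType).
Implicit Types v : R.

(** The part of [v] lying between the heights [k] and [k + 1]. *)
Definition layer (k : nat) v : R :=
  Num.min 1 ((v - k%:R) - Num.min (v - k%:R) 0).

Lemma layer_ge0 k v : 0 <= layer k v.
Proof. by rewrite /layer le_min ler01 subr_ge0 ge_min lexx. Qed.

Lemma layer_le1 k v : layer k v <= 1.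
Proof. by rewrite /layer ge_min lexx. Qed.

Lemma layer_gt0 k v : (0 < layer k v) = (k%:R < v).
Proof.
rewrite /layer lt_min ltr01/= subr_gt0 gt_min ltxx/=.
by rewrite subr_gt0.
Qed.

Lemma sum_layer n v : 0 <= v -> \sum_(k < n) layer k v = Num.min v n%:R.
Proof.
move=> v0; elim: n => [|n IH]; first by rewrite big_ord0 min_r.
rewrite big_ord_recr/= IH /layer -natr1.
have [|] := leP v n%:R; have [|] := leP (v - n%:R) 0;
  have [|] := leP v (n%:R + 1) => *; rewrite ?subrr ?subr0;
  try (rewrite min_r; lra); try (rewrite min_l; lra).
Qed.

Lemma sum_indic_le n v : 0 <= v ->
  \sum_(k < n) ((k%:R < v)%R)%:R <= v + 1.
Proof.
move=> v0; have v10 : 0 <= v + 1 by lra.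
apply: (@le_trans _ _ (Num.min (v + 1) n%:R)); last by rewrite ge_min lexx.
rewrite -sum_layer//; apply: ler_sum => k _.
have [kv|_] := ltP (k%:R : R) v; last exact: layer_ge0.
rewrite /layer [Num.min (v + 1 - _) _]min_r; last lra.
by rewrite le_min lexx/=; lra.
Qed.

End layers.

Section daniell_representation.
Context d (T : measurableType d) (R : realType).
Variables (E : set (T -> R)) (I : (T -> R) -> R).
Hypotheses (algE : lattice_algebra E) (meanI : mean E I)
  (smoothI : sigma_smooth E I).
Hypothesis mE : forall f, E f -> measurable_fun setT f.
Hypothesis genE : @measurable d T `<=`
  <<s [set [set x | 0 < f x] | f in [set f | E f /\ forall x, 0 <= f x]] >>.

Lemma outer_mean_probability : exists mu : probability T R,
  forall A, mu A = outer_mean E I A.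
Proof.
pose mixin := isOuterMeasure.Build R T (outer_mean E I)
  (outer_mean0 algE meanI) (outer_mean_ge0 meanI)
  (@le_outer_mean _ _ _ _ _) (outer_mean_sigma_subadditive algE meanI).
pose m : outer_measure R T := HB.pack (outer_mean E I) mixin.
have cara : @measurable d T `<=` m.-caratheodory.
  apply: subset_trans genE _; apply: smallest_sub.
    split.
    - exact: caratheodory_measurable_set0.
    - by move=> A mA; rewrite setTD; exact: caratheodory_measurable_setC.
    - by move=> F mF; exact: caratheodory_measurable_bigcup.
  move=> _ [f [Ef f0] <-]; apply: le_caratheodory_measurable.
  exact: caratheodory_level_set.
have additive : semi_sigma_additive (outer_mean E I : set T -> \bar R).
  move=> F mF tF _; apply: (@caratheodory_measure_sigma_additive R T m F) => //.
    by move=> k; exact: cara.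
  by apply: caratheodory_measurable_bigcup => k; exact: cara.
pose mixin1 := isMeasure.Build d T R (outer_mean E I) (outer_mean0 algE meanI)
  (outer_mean_ge0 meanI) additive.
pose m1 : measure T R := HB.pack (outer_mean E I) mixin1.
have m1T : m1 setT = 1%E.
  apply/eqP; rewrite eq_le; apply/andP; split.
    by apply: outer_mean_le; exact: coverable1.
  have := @mean_le_outer _ _ _ _ _ algE meanI smoothI (cst 1) (algebra_cst algE 1).
  rewrite (mean1 meanI) => /(_ (fun=> _)) H.
  apply: le_trans (H _) _; first by move=> x; rewrite ler01 lexx.
  by apply: le_outer_mean.
pose mixin2 := Measure_isProbability.Build d T R m1 m1T.
pose m2 : probability T R := HB.pack (outer_mean E I) mixin1 mixin2.
by exists m2.
Qed.

(** Cutting [n * f] into the layers [h k], each of mean at most the measure of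
    [k < n * f], gives [n * I f <= n * J f + 1] for [0 <= f <= 1]. Letting [n]
    grow yields [I <= J], and applying this to [- f] yields equality. *)
Theorem daniell_stone : exists mu : probability T R,
  forall f, E f -> \int[mu]_x f x = I f.
Proof.
have [mu muE] := outer_mean_probability; exists mu.
pose J f := \int[mu]_x f x.
have meanJ : mean E J by exact: mean_Rintegral.
have meas f c : E f -> measurable [set x | c < f x].
  move=> Ef; have := mE Ef measurableT (measurable_itv `]c, +oo[%R).
  by rewrite setTI preimage_itvoy.
have le01 f : E f -> (forall x, 0 <= f x <= 1) -> I f <= J f.
  move=> Ef f01; have f0 x : 0 <= f x by case/andP: (f01 x).
  suff H (n : nat) : n%:R * I f <= n%:R * J f + 1.
    rewrite leNgt; apply/negP => JI.
    have := H (Num.truncn ((I f - J f)^-1)).+1.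
    have := truncnS_gt (I f - J f)^-1.
    have d0 : 0 < I f - J f by rewrite subr_gt0.
    rewrite -(ltr_pM2r d0) mulVf ?gt_eqF//; lra.
  pose v := cst n%:R \* f.
  have Ev : E v by exact: algebraZ.
  have v0 x : 0 <= v x by rewrite mulr_ge0.
  pose h k : T -> R := layer k \o v.
  have Eh k : E (h k).
    apply: algebra_min => //; first exact: algebra_cst.
    have Evk : E (v \- cst k%:R) by apply: algebraB => //; exact: algebra_cst.
    have E0 : E (cst 0) by exact: algebra_cst.
    exact: (algebraB algE Evk (algebra_min algE Evk E0)).
  have vE : v = fun x => \sum_(k < n) h k x.
    apply/funext => x; rewrite sum_layer// min_l// /v/= -[leRHS]mulr1.
    by rewrite ler_wpM2l//; case/andP: (f01 x).
  rewrite -(meanZ meanI) // -(meanZ meanJ)// -/v.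
  rewrite {1}vE (mean_sum algE meanI)//.
  have IL k : I (h k) <= \int[mu]_x \1_[set x | k%:R < v x] x.
    rewrite -lee_fin; apply: le_trans (mean_le_outer algE meanI smoothI (Eh k) _) _.
      by move=> x; rewrite layer_ge0 layer_le1.
    rewrite /Rintegral integral_indic//; last exact: meas.
    rewrite setIT fineK; last by rewrite fin_num_measure//; exact: meas.
    by rewrite [leRHS]muE; apply: le_outer_mean => x /=; rewrite layer_gt0.
  apply: (@le_trans _ _ (\sum_(k < n) \int[mu]_x \1_[set x | k%:R < v x] x)).
    by apply: ler_sum => k _; exact: IL.
  have intI k : mu.-integrable setT (EFin \o (\1_[set x | (k%:R < v x)%R] : T -> R)).
    by apply: integrable_indic; exact: meas.
  have intv : mu.-integrable setT (EFin \o (v \+ cst 1)).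
    have Ev1 : E (v \+ cst 1) by apply: algebraD => //; exact: algebra_cst.
    have [M vM] := algebra_bounded algE Ev1.
    by apply: bounded_integrable vM; exact: mE.
  have -> : J v + 1 = J (v \+ cst 1).
    by rewrite (meanD meanJ) ?(mean1 meanJ)//; exact: algebra_cst.
  rewrite -lee_fin -sumEFin.
  have -> : (\sum_(k < n) (\int[mu]_x \1_[set x | k%:R < v x] x)%:E =
      \int[mu]_x \sum_(k < n) (\1_[set x | (k%:R < v x)%R] x)%:E)%E.
    rewrite (integral_sum measurableT (fun k : 'I_n => intI k)).
    apply: eq_bigr => k _.
    by rewrite /Rintegral fineK//; exact: integrable_fin_num (intI k).
  rewrite /J /Rintegral fineK; last exact: integrable_fin_num intv.
  apply: le_integral => //.
    exact: (integrable_sum measurableT _ (fun (k : 'I_n) _ => intI k)).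
  move=> x _; rewrite sumEFin lee_fin/=.
  apply: le_trans (sum_indic_le n (v0 x)).
  apply: ler_sum => k _; rewrite indicE ler_nat.
  by case: (boolP (x \in _)) => //; rewrite inE /= => ->.
have leIJ f : E f -> I f <= J f.
  move=> Ef; have [M fM] := algebra_bounded algE Ef.
  pose K := Num.max M 1.
  have K0 : 0 < K by rewrite /K lt_max ltr01 orbT.
  have fK x : - K <= f x <= K.
    by rewrite -ler_norml /K le_max fM.
  pose g := cst (2 * K)^-1 \* (f \+ cst K).
  have EfK : E (f \+ cst K) by apply: algebraD => //; exact: algebra_cst.
  have Eg : E g by exact: algebraZ.
  have /le01 : E g by [].
  have EK : E (cst K) by exact: algebra_cst.
  rewrite (meanZ meanI)// (meanZ meanJ)// ler_pM2l ?invr_gt0 ?mulr_gt0//.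
  rewrite (meanD meanI)// (meanD meanJ)// !(mean_cst algE)// lerD2r; apply.
  move=> x; rewrite /g/= mulr_ge0 ?invr_ge0 ?mulr_ge0 ?(ltW K0)//=; last first.
    by have := fK x; lra.
  rewrite mulrC ler_pdivrMr ?mulr_gt0// mul1r; have := fK x; lra.
move=> f Ef; apply/eqP; rewrite eq_le leIJ// andbT.
have := leIJ _ (algebraZ algE (-1) Ef).
by rewrite (meanZ meanI)// (meanZ meanJ)// !mulN1r lerN2.
Qed.

End daniell_representation.

(** * Uniqueness of invariant measures dominated by an ergodic one *)

Section ergodic_comparison.
Context d (T : measurableType d) (R : realType).
Implicit Types (mu la : probability T R) (F : T -> T).

Definition mass mu (A : set T) : R := fine (mu A).

Lemma massE mu A : measurable A -> mu A = (mass mu A)%:E.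
Proof. by move=> mA; rewrite /mass fineK// fin_num_measure. Qed.

Lemma mass_split mu A B : measurable A -> measurable B ->
  mass mu A = mass mu (A `&` B) + mass mu (A `\` B).
Proof.
move=> mA mB; apply: EFin_inj; rewrite EFinD -!massE//.
- by rewrite addeC [LHS](measureDI mu mA mB).
- exact: measurableD.
- exact: measurableI.
Qed.

Lemma massC mu A : measurable A -> mass mu (~` A) = 1 - mass mu A.
Proof.
move=> mA; have := mass_split mu measurableT mA.
by rewrite setTI setTD {1}/mass probability_setT /=; lra.
Qed.

Lemma mass_nondecreasing_cvg mu (A : (set T)^nat) :
  (forall n, measurable (A n)) -> nondecreasing_seq A ->
  mass mu (A n) @[n --> \oo] --> mass mu (\bigcup_n A n).
Proof.
move=> mA ndA; apply: fine_cvg.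
have mU : measurable (\bigcup_n A n) by exact: bigcupT_measurable.
by rewrite -massE//; exact: nondecreasing_cvg_mu.
Qed.

Lemma mass_nonincreasing_cvg mu (A : (set T)^nat) :
  (forall n, measurable (A n)) -> nonincreasing_seq A ->
  mass mu (A n) @[n --> \oo] --> mass mu (\bigcap_n A n).
Proof.
move=> mA niA; apply: fine_cvg.
have mI : measurable (\bigcap_n A n) by exact: bigcapT_measurable.
rewrite -massE//; apply: nonincreasing_cvg_mu => //.
by rewrite ltey_eq fin_num_measure.
Qed.

Lemma hahn_comparison mu la : exists P, [/\ measurable P,
  forall A, measurable A -> A `<=` P -> mass la A <= mass mu A &
  forall A, measurable A -> A `<=` ~` P -> mass mu A <= mass la A].
Proof.
pose c := cadd (charge_of_finite_measure mu)
  (copp (charge_of_finite_measure la)).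
have cE A : measurable A -> c A = (mass mu A - mass la A)%:E.
  move=> mA; rewrite /c /cadd /copp /charge_of_finite_measure /=.
  by rewrite EFinB -!massE.
have [P [N [[mP posP] [mN negN] PNT PN0]]] := Hahn_decomposition c.
exists P; split => // A mA AP.
  by have := posP _ mA AP; rewrite [leRHS]cE// lee_fin subr_ge0.
have AN : A `<=` N by move=> x /AP nPx; have : setT x by []; rewrite -PNT => -[].
by have := negN _ mA AN; rewrite [leLHS]cE// lee_fin subr_le0.
Qed.

(** Comparing with the Hahn decomposition [P] of [mu - la]: adding the missing
    part of [P] to a preimage can only increase [mu - la], so the excess of
    [mu] over [la] on [P] survives on the union of the preimages of [P], hence
    on the invariant intersection of its preimages; but on an invariant set of
    [la]-measure 0 or 1 there is no excess. *)
Lemma ergodic_unique mu la F : measurable_fun setT F -> ergodic la F ->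
  Defs.invariant mu F -> (forall A, measurable A -> la A = 0 -> mu A = 0) ->
  same_measure mu la.
Proof.
move=> mF [invla ergla] invmu mula.
have mFi A : measurable A -> measurable (F @^-1` A).
  by move=> mA; rewrite -[X in measurable X]setTI; exact: mF.
have invm m A : Defs.invariant m F -> measurable A ->
    mass m (F @^-1` A) = mass m A.
  by move=> im mA; rewrite /mass -(im _ mA).
have [P [mP posP negP]] := hahn_comparison mu la.
pose ex A := mass mu A - mass la A.
have exS A B : measurable A -> measurable B ->
    ex A = ex (A `&` B) + ex (A `\` B).
  by move=> mA mB; rewrite /ex (mass_split mu mA mB) (mass_split la mA mB); lra.
have exF A : measurable A -> ex (F @^-1` A) = ex A.
  by move=> mA; rewrite /ex !invm.
have pos A : measurable A -> A `<=` P -> 0 <= ex A.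
  by move=> mA AP; rewrite subr_ge0 posP.
(* [Q n] is the set of the points that reach [P] in at most [n] steps. *)
pose Q n := iter n (fun B => P `|` F @^-1` B) P.
have mQ n : measurable (Q n).
  by elim: n => // n IH; apply: measurableU => //; exact: mFi.
have QS n : Q n `<=` Q n.+1.
  elim: n => [|n IH] x; first by left.
  by case; [left|right; exact: IH].
have exQ n : ex P <= ex (Q n).
  elim: n => // n IH; rewrite (exS (Q n.+1) (F @^-1` Q n))//; last exact: mFi.
  have -> : Q n.+1 `&` F @^-1` Q n = F @^-1` Q n.
    by apply/setIidPr; exact: subsetUr.
  rewrite exF// ler_wpDr// pos//; first by apply: measurableD => //; exact: mFi.
  by move=> x [[]].
pose U := \bigcup_n Q n.
have mU : measurable U by exact: bigcupT_measurable.
have ndQ : nondecreasing_seq Q.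
  by apply/nondecreasing_seqP => n; apply/subsetPset; exact: QS.
have exU : ex P <= ex U.
  have cv : ex (Q n) @[n --> \oo] --> ex U.
    by apply: cvgB; exact: mass_nondecreasing_cvg.
  rewrite -(cvg_lim _ cv)//; apply: limr_ge; first exact: cvgP cv.
  by near=> n; exact: exQ.
have FU : F @^-1` U `<=` U by move=> x [n _ Qx]; exists n.+1 => //; right.
pose V n := iter n (fun B => F @^-1` B) U.
have mV n : measurable (V n) by elim: n => // n IH; exact: mFi.
have VS n : V n.+1 `<=` V n.
  by elim: n => // n IH x; exact: IH.
have niV : nonincreasing_seq V.
  by apply/nonincreasing_seqP => n; apply/subsetPset; exact: VS.
pose W := \bigcap_n V n.
have mW : measurable W by exact: bigcapT_measurable.
have massW m : Defs.invariant m F -> mass m W = mass m U.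
  move=> im; have VU n : mass m (V n) = mass m U.
    by elim: n => // n IH; rewrite -IH; exact: invm.
  have := mass_nonincreasing_cvg (mu := m) mV niV.
  under eq_fun do rewrite VU.
  by move=> /cvg_lim <- //; rewrite lim_cst.
have FW : F @^-1` W = W.
  apply/seteqP; split => x Wx n _; last exact: (Wx n.+1).
  by case: n => [|n]; [apply: (VS 0%N); exact: (Wx 0%N)|exact: (Wx n)].
have exW : ex W = 0.
  have [laW|laW] := ergla _ mW FW.
    by rewrite /ex /mass (mula _ mW laW) laW subrr.
  have : mass la (~` W) = 0 by rewrite massC// /mass laW /= subrr.
  move=> laWC; have /mula : la (~` W) = 0.
    by rewrite massE ?laWC//; exact: measurableC.
  move=> /(_ (measurableC mW)) muWC.
  have {}muWC : mass mu (~` W) = 0 by rewrite /mass muWC.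
  by have := massC mu mW; have := massC la mW; rewrite laWC muWC /ex; lra.
have exP : ex P = 0.
  apply/eqP; rewrite eq_le pos// andbT (le_trans exU)//.
  by rewrite /ex -!massW// -/(ex W) exW.
have exle A : measurable A -> ex A <= 0.
  move=> mA; rewrite (exS _ P)// -(addr0 0) lerD//.
    have := exS P A mP mA; rewrite exP setIC => e.
    have : 0 <= ex (P `\` A) by apply: pos; [exact: measurableD|move=> x []].
    by move: e; lra.
  rewrite subr_le0; apply: negP; first exact: measurableD.
  by move=> x [].
move=> A mA; rewrite !massE//; congr EFin; apply/eqP.
rewrite -subr_eq0 eq_le exle//=.
have := exle _ (measurableC mA); rewrite /ex !massC//; lra.
Unshelve. all: by end_near. Qed.

End ergodic_comparison.

(** * Cozero sets and Borel maps *)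

Section cozero.
Context (R : realType).

Lemma contract_continuous : continuous (@contract R).
Proof.
move=> x; apply/cvgrPdist_lt => e e0.
by apply: filterS (nbhsx_ballx x e e0) => y; rewrite /ball/= /ereal_ball.
Qed.

(** The metrizability of the product enters only through this property, which
    passes through a homeomorphism without any choice of a metric. *)
Definition cozero_space (Z : topologicalType) := forall U : set Z, open U ->
  exists h : Z -> R, [/\ continuous h, forall z, 0 <= h z <= 1 &
    U = [set z | 0 < h z]].

(** The distance to the complement may be infinite, whence [contract]. *)
Lemma pseudometric_cozero (M : pseudoMetricType R) : cozero_space M.
Proof.
move=> U oU; pose A := ~` U; exists (@contract R \o edist_inf A); split.
- move=> z; apply: continuous_comp; first exact: edist_inf_continuous.
  exact: contract_continuous.
- move=> z /=; have := contract_le1 (edist_inf A z).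
  rewrite ler_norml => /andP[_ ->]; rewrite andbT -(@contract0 R).
  by rewrite le_contract edist_inf_ge0.
apply/seteqP; split => z /=; last first.
  by apply: contraPP => Az; rewrite (edist_inf0 Az) contract0 ltxx.
move=> Uz; have /nbhs_ballP[e /= e0 zeU] : nbhs z U by exact: open_nbhs_nbhs.
rewrite -(@contract0 R) lt_contract; apply: lt_le_trans (_ : e%:E <= _)%E.
  by rewrite lte_fin.
apply: le_ereal_inf_tmp => _ [a Aa <-]; rewrite leNgt; apply/negP.
by move=> /edist_lt_ball/zeU.
Qed.

Lemma homeo_cozero (Z Z' : topologicalType) (f : Z -> Z') (g : Z' -> Z) :
  cancel f g -> continuous f -> continuous g -> cozero_space Z' ->
  cozero_space Z.
Proof.
move=> fK cf cg Z'0 U oU.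
have [|h [ch h01 gU]] := Z'0 (g @^-1` U); first by move/continuousP: cg; exact.
exists (h \o f); split => [z|z|].
  by apply: continuous_comp; [exact: cf|exact: ch].
  exact: h01.
have -> : U = f @^-1` (g @^-1` U).
  by apply/funext => z; rewrite /preimage /= fK.
by rewrite gU.
Qed.

End cozero.

Section borel_maps.
Context (R : realType).

Lemma open_borel (Z : ptopologicalType) (U : set Z) : open U ->
  measurable (U : set (borel Z)).
Proof. by move=> oU; exact: sub_sigma_algebra. Qed.

Lemma borel_measurable_fun d (T : measurableType d) (Z : ptopologicalType)
    (f : T -> borel Z) :
  (forall U : set Z, open U -> measurable (f @^-1` U)) ->
  measurable_fun setT f.
Proof.
move=> mf; apply: (@measurability _ _ T (borel Z) setT f (@open Z)) => //.
by move=> _ [U oU <-]; rewrite setTI; exact: mf.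
Qed.

Lemma continuous_borel (Z W : ptopologicalType) (f : Z -> W) :
  continuous f -> measurable_fun setT (f : borel Z -> borel W).
Proof.
move=> cf; apply: borel_measurable_fun => U oU; apply: open_borel.
by move/continuousP: cf; exact.
Qed.

Lemma continuous_borel_real (Z : ptopologicalType) (f : Z -> R) :
  continuous f -> measurable_fun setT (f : borel Z -> R).
Proof.
move=> /continuousP cf; apply: (measurability _ (RGenOpens.measurableE R)).
move=> _ [_ [a [b ->] <-]]; rewrite setTI; apply: open_borel.
exact/cf/interval_open.
Qed.

Lemma preimage_borel d (T : measurableType d) (Z : ptopologicalType)
    (f : T -> borel Z) (A : set (borel Z)) :
  measurable_fun setT f -> measurable A -> measurable (f @^-1` A).
Proof. by move=> mf mA; rewrite -[X in measurable X]setTI; exact: mf. Qed.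

End borel_maps.

Lemma countable_bigcup_measurable d (T : measurableType d) (U : Type)
    (D : set U) (F : U -> set T) : countable D ->
  (forall i, D i -> measurable (F i)) -> measurable (\bigcup_(i in D) F i).
Proof.
move=> /countable_injP[f injf] mF.
rewrite (_ : \bigcup_(i in D) F i =
    \bigcup_n \bigcup_(i in [set i | D i /\ f i = n]) F i); last first.
  apply/seteqP; split => [x [i Di Fi]|x [n _ [i [Di _] Fi]]]; last by exists i.
  by exists (f i) => //; exists i.
apply: bigcupT_measurable => n.
have [[i [Di fi]]|nD] := pselect (exists i, D i /\ f i = n).
  rewrite (_ : \bigcup_(i in _) _ = F i); first exact: mF.
  apply/seteqP; split => [x [j [Dj fj]]|x Fi]; last by exists i.
  by rewrite (injf j i) ?inE// fj.
rewrite (_ : \bigcup_(i in _) _ = set0)//.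
by apply/seteqP; split => // x [i Di _]; apply: nD; exists i.
Qed.

Lemma countable_bigcap_measurable d (T : measurableType d) (U : Type)
    (D : set U) (F : U -> set T) : countable D ->
  (forall i, D i -> measurable (F i)) -> measurable (\bigcap_(i in D) F i).
Proof.
move=> cD mF; rewrite -[X in measurable X]setCK setC_bigcap.
apply: measurableC; apply: countable_bigcup_measurable => // i Di.
exact/measurableC/mF.
Qed.

Section rectangles.
Context (X Y : ptopologicalType).

Lemma continuous_fst : continuous (fst : X * Y -> X).
Proof. by move=> z; exact: cvg_fst. Qed.

Lemma continuous_snd : continuous (snd : X * Y -> Y).
Proof. by move=> z; exact: cvg_snd. Qed.

Lemma continuous_pair (x : X) : continuous (pair x : Y -> X * Y).
Proof. by move=> y; apply: cvg_pair; [exact: cvg_cst|exact: cvg_id]. Qed.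

Lemma continuous_pair_fst (y : Y) : continuous (fun x : X => (x, y)).
Proof. by move=> x; apply: cvg_pair; [exact: cvg_id|exact: cvg_cst]. Qed.

(** Each [b] in the base is paired with the largest open set of [y] for which
    the rectangle lies in [U], so a countable base of [X] is enough to have
    countably many rectangles, whatever the weight of [Y]. *)
Lemma open_rectangles (B : set (set X)) (U : set (X * Y)) :
  basis B -> open U ->
  U = \bigcup_(b in B) [set z | b z.1 /\
    [set y | forall x, b x -> U (x, y)]° z.2].
Proof.
move=> [oB bB] oU; apply/seteqP; split => [[x y] Uxy|[x y] [b Bb [/= bx]]].
  have [[P Q] /= [Px Qy] PQU] : nbhs (x, y) U by exact: open_nbhs_nbhs.
  have [b [Bb bx] bP] := bB x P Px; exists b => //; split => //=.
  apply: filterS Qy => y' Qy' x' bx'; apply: (PQU (x', y')).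
  by split => //; exact: bP.
by move=> /interior_subset; exact.
Qed.

(** A preimage of a rectangle is the intersection of two Borel sets, and by
    [open_rectangles] countably many rectangles make up an open set. *)
Lemma measurable_prod_map (S : X -> X) (T : Y -> Y) : @second_countable X ->
  continuous S -> measurable_fun [set: borel Y] (T : borel Y -> borel Y) ->
  measurable_fun setT (prod_map S T : borel (X * Y)%type -> borel (X * Y)%type).
Proof.
move=> [B cB bB] cS mT; apply: borel_measurable_fun => U oU.
rewrite (open_rectangles bB oU) preimage_bigcup.
apply: countable_bigcup_measurable => // b Bb.
have oV : open [set y | forall x, b x -> U (x, y)]° by exact: open_interior.
rewrite [X in measurable X](_ : _ = (fst @^-1` (S @^-1` b)) `&`
    (snd @^-1` (T @^-1` [set y | forall x, b x -> U (x, y)]°))); last first.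
  by apply/seteqP; split.
apply: measurableI.
  apply: open_borel; move/continuousP: continuous_fst; apply.
  by move/continuousP: cS; apply; case: bB => + _; exact.
apply: (preimage_borel (continuous_borel continuous_snd)).
by apply: preimage_borel => //; exact: open_borel.
Qed.

End rectangles.

(** * Integrands and functionals with a prescribed marginal *)

Section caratheodory_integrands.
Context (R : realType) (X Y : ptopologicalType).
Implicit Types f : X * Y -> R.

(** These are the bounded Caratheodory functions, with the roles of the
    variables such that a merely Borel map may act on [y]. *)
Definition integrands : set (borel (X * Y)%type -> R) :=
  [set f : borel (X * Y)%type -> R | [/\ measurable_fun setT f,
    forall y, continuous (fun x : X => f (x, y)) &
    exists M : R, forall z, `|f z| <= M]].

Lemma integrand_algebra : lattice_algebra integrands.
Proof.
split.
- move=> c; split; first exact: measurable_cst.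
    by move=> y x; exact: cvg_cst.
  by exists `|c|.
- move=> f g [mf cf [M fM]] [mg cg [N gN]]; split; first exact: measurable_funD.
    by move=> y x; apply: cvgD; [exact: cf|exact: cg].
  exists (M + N) => z /=; apply: le_trans (ler_normD _ _) _.
  exact: lerD.
- move=> f g [mf cf [M fM]] [mg cg [N gN]]; split; first exact: measurable_funM.
    by move=> y x; apply: cvgM; [exact: cf|exact: cg].
  by exists (M * N) => z /=; rewrite normrM ler_pM.
- move=> f g [mf cf [M fM]] [mg cg [N gN]]; split; first exact: measurable_minr.
    move=> y x.
    exact: (@continuous_min R X (fun x => f (x, y)) (fun x => g (x, y)) x
      (cf y x) (cg y x)).
  exists (Num.max M N) => z /=; rewrite le_max.
  by case: (leP (f z) (g z)) => _; rewrite ?fM ?gN ?orbT.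
- by move=> f [].
Qed.

Lemma integrand_measurable f : integrands f ->
  measurable_fun setT (f : borel (X * Y)%type -> R).
Proof. by case. Qed.

Lemma integrand_continuous f : continuous f -> (exists M : R, forall z, `|f z| <= M) ->
  integrands f.
Proof.
move=> cf bf; split => //; first exact: continuous_borel_real.
by move=> y x; apply: continuous_comp; [exact: continuous_pair_fst|exact: cf].
Qed.

Lemma integrand_snd (g : borel Y -> R) : measurable_fun setT g ->
  (exists M : R, forall y, `|g y| <= M) -> integrands (g \o snd).
Proof.
move=> mg [M gM]; split.
- apply: (measurableT_comp mg).
  exact: (continuous_borel (@continuous_snd X Y)).
- by move=> y x; exact: cvg_cst.
- by exists M => z /=.
Qed.

Lemma integrand_indic (B : set (borel Y)) : measurable B ->
  integrands ((\1_B : borel Y -> R) \o snd).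
Proof.
move=> mB; apply: integrand_snd; first exact: measurable_indic.
by exists 1 => y; rewrite indicE; case: (_ \in _); rewrite ?normr1 ?normr0.
Qed.

Lemma integrand_comp (S : X -> X) (T : Y -> Y) f : @second_countable X ->
  continuous S -> measurable_fun [set: borel Y] (T : borel Y -> borel Y) ->
  integrands f -> integrands (f \o prod_map S T).
Proof.
move=> X2 cS mT [mf cf [M fM]]; split.
- by apply: (measurableT_comp mf); exact: measurable_prod_map.
- move=> y x; apply: (@continuous_comp _ _ _ S (fun x => f (x, T y))).
    exact: cS.
  exact: cf.
- by exists M => z /=.
Qed.

Lemma borel_integrands : cozero_space R (X * Y)%type ->
  @measurable _ (borel (X * Y)%type) `<=` <<s [set [set z | 0 < f z] |
    f in [set f | integrands f /\ forall z, 0 <= f z]] >>.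
Proof.
move=> coz; apply: sub_sigma_algebra2 => U oU.
have [h [ch h01 ->]] := coz U oU.
exists h => //; split; last by move=> z; case/andP: (h01 z).
apply: integrand_continuous => //; exists 1 => z.
by have /andP[h0 h1] := h01 z; rewrite ger0_norm.
Qed.

End caratheodory_integrands.

Section smoothness.
Context (R : realType) (X : ptopologicalType).

(** The choice of a point in each set of a countable base is dense, so the
    supremum of a continuous function is a countable supremum. *)
Lemma second_countable_dense : @second_countable X ->
  exists2 D : set X, countable D & forall (f : X -> R) c, continuous f ->
    (forall x, D x -> f x <= c) -> forall x, f x <= c.
Proof.
move=> [B cB [oB bB]]; exists (xget point @` B).
  exact: sub_countable (card_image_le _ _) cB.
move=> f c cf fc x; rewrite leNgt; apply/negP => cfx.
have [b [Bb bx] bsub] : exists2 b, B b /\ b x & b `<=` [set x | c < f x].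
  have := bB x [set x | c < f x]; apply; apply: (cf x [set r | c < r]).
  by apply: open_nbhs_nbhs; split => //; exact: open_gt.
have /bsub/= : b (xget point b) by apply: xgetPex; exists x.
by rewrite ltNge fc//; exists b.
Qed.

Lemma dini (f : nat -> X -> R) (e : R) : compact [set: X] ->
  (forall n, continuous (f n)) -> (forall n x, f n.+1 x <= f n x) ->
  (forall x (e : R), 0 < e -> exists n, f n x <= e) -> 0 < e ->
  exists n, forall x, f n x <= e.
Proof.
move=> /compact_near_coveringP cX cf fS f0 e0.
have fle x : {homo f ^~ x : m n / (m <= n)%N >-> n <= m}.
  by apply: homo_leq => [//|y u v uy vu|i]; [exact: le_trans vu uy|exact: fS].
have [|N _ NX] := cX nat \oo (fun n x => f n x <= e) _.
  move=> x _; have [N fN] := f0 x (e / 2) (divr_gt0 e0 (ltr0Sn R 1)).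
  have fNe : f N x < e by rewrite (le_lt_trans fN)// ltr_pdivrMr// ltr_pMr// ltr1n.
  exists ([set x | f N x < e], [set n | (N <= n)%N]).
    split => /=; last by exists N.
    apply: (cf N x [set r | r < e]).
    by apply: open_nbhs_nbhs; split => //; exact: open_lt.
  by move=> [x' n] [/= fx' Nn]; rewrite (le_trans (fle x' _ _ Nn))// ltW.
by exists N => x; apply: (NX N) => //=.
Qed.

End smoothness.

Section joining_functionals.
Context (R : realType) (X Y : ptopologicalType) (nu : probability (borel Y) R).

(** The integral of a joining is such a functional, but so are the limits of
    these integrals along an ultrafilter, before any measure represents them. *)
Record joining_functional (J : (X * Y -> R) -> R) : Prop := JoiningFunctional {
  joining_mean : mean (@integrands R X Y) J;
  joining_marginal : forall B : set (borel Y), measurable B ->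
    J (\1_B \o snd) = mass nu B }.

(** Only the second marginal has to be sigma-additive: by Dini's theorem
    [f n <= e] holds on the whole fibre over [y] for [n] large, so that the
    complement of the set [G n] of such [y] has small measure. *)
Lemma joining_functional_smooth J : compact [set: X] -> @second_countable X ->
  joining_functional J -> sigma_smooth (@integrands R X Y) J.
Proof.
move=> cX X2 [meanJ margJ] f Ef f0 fS fi e e0.
have [M fM] : exists M : R, forall z, `|f 0%N z| <= M by case: (Ef 0%N).
have M0 : 0 <= M by exact: le_trans (fM point).
have algE := @integrand_algebra R X Y.
have fle z n : f n z <= M.
  apply: le_trans (fM z); rewrite ger0_norm//.
  by elim: n => // n IH; exact: le_trans (fS n z) IH.
pose G n := [set y : borel Y | forall x : X, f n (x, y) <= e / 2].
have e20 : 0 < e / 2 by rewrite divr_gt0.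
have mG n : measurable (G n).
  have [D cD Dsup] := second_countable_dense R X2.
  have [mf cf _] := Ef n.
  rewrite (_ : G n = \bigcap_(x in D) [set y | f n (x, y) <= e / 2]).
    apply: countable_bigcap_measurable => // x _.
    rewrite (_ : [set y | _] = pair x @^-1` [set z | f n z <= e / 2])//.
    apply: (preimage_borel (continuous_borel (@continuous_pair X Y x))).
    rewrite -[X in measurable X]setTI -preimage_itvNyc.
    by apply: mf => //; exact: measurable_itv.
  apply/seteqP; split => y Gy x; first by move=> _; exact: Gy.
  by apply: (Dsup (fun x => f n (x, y))) => // x' Dx'; exact: Gy.
have GS n : G n `<=` G n.+1.
  by move=> y Gy x; exact: le_trans (fS _ _) (Gy x).
have GT : \bigcup_n G n = setT.
  rewrite -subTset => y _.
  have cfy n : continuous (fun x => f n (x, y)) by case: (Ef n).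
  have [n fn] := dini cX cfy (fun n x => fS n (x, y)) (fun x => fi (x, y)) e20.
  by exists n.
have := mass_nondecreasing_cvg (mu := nu) mG.
rewrite GT {2}/mass probability_setT /= => cvG.
have {}cvG : mass nu (G n) @[n --> \oo] --> (1 : R).
  by apply: cvG; apply/nondecreasing_seqP => n; apply/subsetPset; exact: GS.
(* [M + 1] rather than [M] because [M] may vanish. *)
have d0 : 0 < e / 2 / (M + 1) by rewrite divr_gt0// ltr_wpDl.
have /cvgrPdist_le/(_ _ d0)[N _ NG] := cvG.
exists N; have := NG N (leqnn N).
rewrite -massC// => nuG.
have {}nuG : mass nu (~` G N) <= e / 2 / (M + 1) by exact: le_trans (ler_norm _) nuG.
have mGC : measurable (~` G N) by exact: measurableC.
have Ei := @integrand_indic R X Y _ mGC.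
have Ec : @integrands R X Y (cst (e / 2)) by exact: (algebra_cst algE).
have EM : @integrands R X Y (cst M \* (\1_(~` G N) \o snd)) by exact: (algebraZ algE M Ei).
apply: (@le_trans _ _ (J (cst (e / 2) \+ (cst M \* (\1_(~` G N) \o snd))))).
  apply: (mean_le algE meanJ) => //; first exact: (algebraD algE Ec EM).
  move=> [x y] /=; rewrite indicE.
  have [yG|/negP] := boolP (y \in ~` G N); first by rewrite mulr1 ler_wpDl// ltW.
  rewrite inE mulr0 addr0 => /contrapT; exact.
rewrite (meanD meanJ)// (mean_cst algE meanJ) (meanZ meanJ)// margJ//.
apply: (@le_trans _ _ (e / 2 + M * (e / 2 / (M + 1)))).
  by rewrite lerD2l ler_wpM2l.
have : M * (e / 2 / (M + 1)) <= e / 2; last by lra.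
rewrite mulrCA ger_pMr// ler_pdivrMr ?mul1r ?ltr_wpDl//; lra.
Qed.

Theorem joining_functional_measure J : compact [set: X] -> @second_countable X ->
  cozero_space R (X * Y)%type -> joining_functional J ->
  exists mu : probability (borel (X * Y)%type) R,
    (forall f, @integrands R X Y f -> \int[mu]_z f z = J f) /\
    forall B : set (borel Y), measurable B -> mu (snd @^-1` B) = nu B.
Proof.
move=> cX X2 coz JJ; have [meanJ margJ] := JJ.
have [mu muJ] := daniell_stone (@integrand_algebra R X Y) meanJ
  (joining_functional_smooth cX X2 JJ) (@integrand_measurable R X Y)
  (borel_integrands coz).
exists mu; split => // B mB.
have mB2 : measurable ((snd @^-1` B) : set (borel (X * Y)%type)).
  by apply: preimage_borel => //; exact: (continuous_borel (@continuous_snd X Y)).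
rewrite massE// (massE nu)//; congr EFin.
rewrite -margJ// -muJ; last exact: integrand_indic.
by rewrite /mass -[X in mu X]setIT -(integral_indic mu measurableT).
Qed.

End joining_functionals.

(** * Images, uniqueness, ultralimits *)

Section measure_lemmas.
Context d (T : measurableType d) (R : realType).

Lemma le_integral_limit (mu : {measure set T -> \bar R}) (e : nat -> T -> R)
    (g : T -> R) (c : \bar R) :
  (forall n, measurable_fun setT (e n)) -> (forall n x, 0 <= e n x) ->
  (forall n x, e n x <= e n.+1 x) ->
  (forall x, e n x @[n --> \oo] --> g x) ->
  (forall n, \int[mu]_x (e n x)%:E <= c)%E -> (\int[mu]_x (g x)%:E <= c)%E.
Proof.
move=> me e0 eS eg ec.
have nde x : {homo (fun n => (e n x)%:E) : m n / (m <= n)%N >-> (m <= n)%E}.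
  by move=> m n mn; rewrite lee_fin; exact: (homo_seq x eS).
have -> : (\int[mu]_x (g x)%:E = \int[mu]_x limn (fun n => (e n x)%:E))%E.
  apply: eq_integral => x _; apply/esym/cvg_lim => //.
  by apply: cvg_EFin => //; [exact: nearW|exact: eg].
rewrite monotone_convergence//.
- apply: lime_le; last by exact: nearW.
  apply: ereal_nondecreasing_is_cvgn => m n mn; apply: ge0_le_integral => //.
  + by move=> x _; rewrite lee_fin.
  + exact/measurable_EFinP.
  + exact/measurable_EFinP.
  + by move=> x _; exact: nde.
- by move=> n; exact/measurable_EFinP.
- by move=> n x _; rewrite lee_fin.
Qed.

Lemma image_probability d' (T' : measurableType d') (mu : probability T R)
    (F : T -> T') : measurable_fun setT F ->
  exists p : probability T' R, forall A, p A = mu (F @^-1` A).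
Proof.
move=> mF; pose G : {mfun T >-> T'} := HB.pack F (isMeasurableFun.Build _ _ _ _ _ mF).
by exists (distribution mu G).
Qed.

Lemma ge0_integral_image d' (T' : measurableType d') (mu : probability T R)
    (p : probability T' R) (F : T -> T') (f : T' -> \bar R) :
  measurable_fun setT F ->
  (forall A, measurable A -> p A = mu (F @^-1` A)) ->
  measurable_fun setT f -> (forall x, 0 <= f x)%E ->
  (\int[p]_x f x = \int[mu]_x f (F x))%E.
Proof.
move=> mF pE mf f0; transitivity (\int[pushforward mu F]_x f x)%E.
  by apply: eq_measure_integral => A mA _; exact: pE.
by rewrite ge0_integral_pushforward.
Qed.

Lemma Rintegral_image d' (T' : measurableType d') (mu : probability T R)
    (p : probability T' R) (F : T -> T') (f : T' -> R) :
  measurable_fun setT F ->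
  (forall A, measurable A -> p A = mu (F @^-1` A)) ->
  measurable_fun setT f -> (exists M : R, forall x, `|f x| <= M) ->
  \int[p]_x f x = \int[mu]_x f (F x).
Proof.
move=> mF pE mf [M fM]; rewrite /Rintegral; congr fine.
transitivity (\int[pushforward mu F]_x (f x)%:E)%E.
  by apply: eq_measure_integral => A mA _; exact: pE.
rewrite (integral_pushforward mF)// ?preimage_setT//; first exact/measurable_EFinP.
apply: (@bounded_integrable _ _ _ mu (f \o F) M).
  exact: measurableT_comp.
by move=> x; exact: fM.
Qed.

End measure_lemmas.

Section uniqueness.
Context (R : realType) (Z : ptopologicalType).

(** Each open set is the increasing limit of the ramps of a continuous
    function, so the integrals of bounded continuous functions determine the
    measure on the pi-system of open sets. *)
Lemma cozero_measure_unique (mu mu' : probability (borel Z) R) :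
  cozero_space R Z ->
  (forall f : Z -> R, continuous f -> (exists M : R, forall z, `|f z| <= M) ->
    \int[mu]_z f z = \int[mu']_z f z) ->
  same_measure mu mu'.
Proof.
move=> coz; move: mu mu'.
suff le (mu mu' : probability (borel Z) R) :
  (forall f : Z -> R, continuous f -> (exists M : R, forall z, `|f z| <= M) ->
    \int[mu]_z f z = \int[mu']_z f z) ->
  forall U : set Z, open U -> (mu U <= mu' U)%E.
  move=> mu mu' mumu' A mA.
  apply: (@measure_unique _ R (borel Z) (@open Z) (fun=> setT) _ _ _ _ mu mu') => //.
  - by move=> B C oB oC; exact: openI.
  - by move=> _; exact: openT.
  - by rewrite bigcup_const//; exists 0%N.
  - move=> U oU; apply/eqP; rewrite eq_le le//= le// => f cf bf.
    by rewrite mumu'.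
  - by move=> _; rewrite [X in (X < _)%E]probability_setT ltry.
move=> mumu' U oU; have [h [ch h01 UE]] := coz U oU.
have h0 z : 0 <= h z by case/andP: (h01 z).
have cr n : continuous (ramp h n).
  move=> z; apply: (@continuous_min R Z); first exact: cvg_cst.
  by apply: cvgM; [exact: cvg_cst|exact: ch].
have br n : forall z, `|ramp h n z| <= 1.
  by move=> z; rewrite ger0_norm ?ramp_ge0// ramp_le1.
have mr n : measurable_fun setT (ramp h n : borel Z -> R).
  exact: continuous_borel_real.
have mU : measurable (U : set (borel Z)) by exact: open_borel.
have intE (m : probability (borel Z) R) n :
    (\int[m]_z (ramp h n z)%:E = (\int[m]_z ramp h n z)%:E)%E.
  rewrite /Rintegral fineK// integrable_fin_num//.
  exact: (bounded_integrable m (mr n) (br n)).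
have massI (m : probability (borel Z) R) :
    (m U = \int[m]_z (\1_U z)%:E)%E.
  by rewrite (integral_indic m measurableT mU) setIT.
rewrite !massI.
apply: (@le_integral_limit _ _ _ mu (ramp h) (\1_U)) => //.
- by move=> n z; exact: ramp_ge0.
- by move=> n z; exact: ramp_leS.
- move=> z; rewrite indicE; have [hz|hz] := ltP 0 (h z).
    have [N hN] := ramp1 hz.
    rewrite mem_set ?UE//; apply: cvg_near_cst; near=> n.
    by apply: hN; near: n; exact: nbhs_infty_ge.
  have {}hz : h z = 0 by apply/eqP; rewrite eq_le hz h0.
  rewrite memNset ?UE//=; last by rewrite hz ltxx.
  by under eq_fun do rewrite ramp0//; exact: cvg_cst.
- move=> n; rewrite intE mumu'//; last by exists 1.
  rewrite -intE.
  apply: ge0_le_integral => //.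
  + by move=> z _; rewrite lee_fin ramp_ge0.
  + exact/measurable_EFinP.
  + exact/measurable_EFinP/measurable_indic.
  + move=> z _; rewrite lee_fin indicE; have [hz|hz] := ltP 0 (h z).
      by rewrite mem_set ?UE// ramp_le1.
    by rewrite ramp0//; apply/eqP; rewrite eq_le hz h0.
Unshelve. all: by end_near. Qed.

End uniqueness.

Section ultralimits.
Context (R : realType).

(** A cluster point exists by compactness, and an ultrafilter contains each
    neighbourhood of it or the complement of that neighbourhood. *)
Lemma ultra_bounded_cvg (I : Type) (U : set_system I) (u : I -> R) M :
  UltraFilter U -> (\forall i \near U, `|u i| <= M) -> cvg (u @ U).
Proof.
move=> UU uM; have [|l [_ ul]] := @segment_compact R (- M) M (u @ U) _.
  by near=> i; rewrite /= in_itv/= -ler_norml; near: i.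
apply/cvg_ex; exists l; apply/cvgrPdist_lt => e e0.
have [//|Ue] := in_ultra_setVsetC [set i | `|l - u i| < e] UU.
have [|r [/= ru rl]] := ul [set r | ~ `|l - r| < e] (ball l e) Ue.
  exact: nbhsx_ballx.
by [].
Unshelve. all: by end_near. Qed.

End ultralimits.

Section ultralimit_joinings.
Context (R : realType) (X Y : ptopologicalType) (nu : probability (borel Y) R).
Context (I : Type) (U : set_system I).
Hypothesis UU : UltraFilter U.
Variable J : I -> (X * Y -> R) -> R.
Hypothesis UJ : \forall i \near U, joining_functional nu (J i).

Definition ultralimit (f : X * Y -> R) : R := lim (J i f @[i --> U]).

Lemma ultralimit_cvg f : @integrands R X Y f ->
  J i f @[i --> U] --> ultralimit f.
Proof.
move=> Ef; have [_ _ [M fM]] := Ef.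
apply: (@ultra_bounded_cvg R I U (fun i => J i f) M UU).
have algE := @integrand_algebra R X Y.
near=> i; have [meanJ _] : joining_functional nu (J i) by near: i.
have EM c : @integrands R X Y (cst c) by exact: (algebra_cst algE).
rewrite ler_norml -[X in X <= _ <= _](mean_cst algE meanJ (- M)).
rewrite -[X in _ <= _ <= X](mean_cst algE meanJ M).
by rewrite !(mean_le algE meanJ)// => z; have := fM z; rewrite ler_norml => /andP[].
Unshelve. all: by end_near. Qed.

Lemma ultralimitE f l : J i f @[i --> U] --> l -> ultralimit f = l.
Proof. by move=> /cvg_lim; exact. Qed.

Lemma ultralimit_joining : joining_functional nu ultralimit.
Proof.
have algE := @integrand_algebra R X Y; split; first split.
- apply: ultralimitE; apply: cvg_near_cst.
  by near=> i; have [[]] : joining_functional nu (J i) by near: i.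
- move=> f g Ef Eg; apply: ultralimitE.
  apply: (@cvg_trans _ ((J i f + J i g) @[i --> U])); last first.
    by apply: cvgD; exact: ultralimit_cvg.
  apply: near_eq_cvg; near=> i.
  have [[_ JD _ _] _] : joining_functional nu (J i) by near: i.
  by rewrite JD.
- move=> c f Ef; apply: ultralimitE.
  apply: (@cvg_trans _ ((c * J i f) @[i --> U])); last first.
    by apply: cvgMr; exact: ultralimit_cvg.
  apply: near_eq_cvg; near=> i.
  have [[_ _ JZ _] _] : joining_functional nu (J i) by near: i.
  by rewrite JZ.
- move=> f Ef f0; apply: limr_ge; first exact: (cvgP _ (ultralimit_cvg Ef)).
  near=> i; have [[_ _ _ J0] _] : joining_functional nu (J i) by near: i.
  exact: J0.
- move=> B mB; apply: ultralimitE; apply: cvg_near_cst.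
  near=> i; have [_ JB] : joining_functional nu (J i) by near: i.
  exact: JB.
Unshelve. all: by end_near. Qed.

End ultralimit_joinings.

(** * Joinings *)

Section joinings.
Context (R : realType) (X Y : ptopologicalType).
Variables (S : X -> X) (T : Y -> Y) (nu : probability (borel Y) R).
Hypotheses (compactX : compact [set: X]) (X2 : @second_countable X)
  (coz : cozero_space R (X * Y)%type) (cS : continuous S)
  (mT : measurable_fun [set: borel Y] (T : borel Y -> borel Y)).

Let F := prod_map S T.
Let E := @integrands R X Y.

Lemma measurable_joint :
  measurable_fun setT (F : borel (X * Y)%type -> borel (X * Y)%type).
Proof. exact: measurable_prod_map. Qed.

Lemma measurable_second :
  measurable_fun setT (snd : borel (X * Y)%type -> borel Y).
Proof. exact: (continuous_borel (@continuous_snd X Y)). Qed.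

Lemma marginal_joining_functional (la : probability (borel (X * Y)%type) R) :
  (forall B : set (borel Y), measurable B -> la (snd @^-1` B) = nu B) ->
  joining_functional nu (fun f => \int[la]_z f z).
Proof.
move=> marg; split.
  by apply: mean_Rintegral; [exact: integrand_algebra|exact: integrand_measurable].
move=> B mB; rewrite /mass -marg//.
have mB2 := preimage_borel measurable_second mB.
by rewrite -[X in la X]setIT -(integral_indic la measurableT mB2).
Qed.

Lemma invariant_of_integrals (mu : probability (borel (X * Y)%type) R) :
  (forall f, E f -> \int[mu]_z f (F z) = \int[mu]_z f z) ->
  Defs.invariant mu (F : borel (X * Y)%type -> borel (X * Y)%type).
Proof.
move=> invf A mA; have [p pE] := image_probability mu measurable_joint.
rewrite /pushforward -pE; apply: (cozero_measure_unique coz) => // f cf bf.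
have Ef : E f by exact: integrand_continuous.
rewrite (Rintegral_image measurable_joint (fun A _ => pE A))//.
  exact: invf.
exact: continuous_borel_real.
Qed.

(** Invariance passes from functionals to measures because the integrands are
    stable under composition with [F]. *)
Lemma invariant_functional_joining J : joining_functional nu J ->
  (forall f, E f -> J (f \o F) = J f) ->
  exists2 mu, joinings S T nu mu & forall f, E f -> \int[mu]_z f z = J f.
Proof.
move=> JJ invJ.
have [mu [muJ marg]] := joining_functional_measure compactX X2 coz JJ.
exists mu => //; split => //; apply: invariant_of_integrals => f Ef.
have EfF : E (f \o F) by exact: integrand_comp.
by rewrite -[LHS]/(\int[mu]_z (f \o F) z) !muJ// invJ.
Qed.

Lemma joinings_functional (la : probability (borel (X * Y)%type) R) :
  joinings S T nu la -> joining_functional nu (fun f => \int[la]_z f z).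
Proof. by move=> [_ marg]; exact: marginal_joining_functional. Qed.

Lemma joinings_invariant (la : probability (borel (X * Y)%type) R) f :
  joinings S T nu la -> E f -> \int[la]_z f (F z) = \int[la]_z f z.
Proof.
move=> [inv _] [mf _ bf]; apply/esym.
apply: (Rintegral_image (T' := borel (X * Y)%type) measurable_joint) => //.
by move=> A mA; rewrite -inv.
Qed.

Lemma joinings_ultralimit (I : Type) (U : set_system I)
    (la : I -> probability (borel (X * Y)%type) R) : UltraFilter U ->
  (\forall i \near U, joinings S T nu (la i)) ->
  exists2 mu, joinings S T nu mu &
    forall f, E f -> \int[la i]_z f z @[i --> U] --> \int[mu]_z f z.
Proof.
move=> UU Ula; pose J i f := \int[la i]_z f z.
have UJ : \forall i \near U, joining_functional nu (J i).
  by apply: filterS Ula => i; exact: joinings_functional.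
have [|mu mujoin muJ] := invariant_functional_joining (ultralimit_joining UU UJ).
  move=> f Ef; apply: ultralimitE.
  apply: (cvg_trans _ (ultralimit_cvg UU UJ Ef)).
  apply: near_eq_cvg; near=> i; apply/esym.
  by apply: joinings_invariant => //; near: i.
by exists mu => // f Ef; rewrite muJ//; exact: (ultralimit_cvg UU UJ Ef).
Unshelve. all: by end_near. Qed.

(** Krylov--Bogoliubov: the measure [p k], image of [nu] under
    [y |-> F^k (point, y)], has marginal [nu] because [nu] is [T]-invariant, and
    an ultralimit of the Cesaro means of these measures is [F]-invariant. *)
Theorem joinings_nonempty : ergodic nu T -> joinings S T nu !=set0.
Proof.
move=> [invT _].
pose G k : borel Y -> borel (X * Y)%type := fun y => iter k F (point, y).
have mG k : measurable_fun setT (G k).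
  elim: k => [|k IH]; first exact: (continuous_borel (@continuous_pair X Y point)).
  exact: (measurableT_comp measurable_joint IH).
have /choice[p pE] : forall k, exists p : probability (borel (X * Y)%type) R,
    forall A, p A = nu (G k @^-1` A).
  by move=> k; exact: image_probability (mG k).
have marg k (B : set (borel Y)) : measurable B -> p k (snd @^-1` B) = nu B.
  move=> mB; rewrite pE -comp_preimage.
  rewrite (_ : snd \o G k = iter k T); last first.
    by apply/funext; elim: k => // k IH y; rewrite /= -IH.
  have mI n : measurable (iter n T @^-1` B : set (borel Y)).
    have mTn : measurable_fun setT (iter n T : borel Y -> borel Y).
      elim: n => [|n IH]; first exact: measurable_id.
      exact: (measurableT_comp mT IH).
    exact: (preimage_borel mTn mB).
  elim: k => // k IH; rewrite -IH -[RHS](invT _ (mI k)); congr (nu _).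
  by apply/funext => y; rewrite /preimage/= -iterSr.
pose K k f := \int[p k]_z f z.
have KJ k : joining_functional nu (K k).
  by apply: marginal_joining_functional => B; exact: marg.
have KS k f : E f -> K k (f \o F) = K k.+1 f.
  move=> [mf _ bf]; rewrite /K.
  have mpk : forall A, measurable A -> p k.+1 A = p k (F @^-1` A).
    by move=> A mA; rewrite !pE.
  by apply/esym; apply: (Rintegral_image (T' := borel (X * Y)%type)
    measurable_joint mpk).
pose J n f := n.+1%:R^-1 * \sum_(k < n.+1) K k f.
have JJ n : joining_functional nu (J n).
  have n0 : n.+1%:R != 0 :> R by rewrite pnatr_eq0.
  split; first split.
  - rewrite /J (eq_bigr (fun=> 1)); last by move=> k _; case: (KJ k) => -[].
    by rewrite sumr_const card_ord mulVf.
  - move=> f g Ef Eg; rewrite /J -mulrDr -big_split/=; congr (_ * _).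
    by apply: eq_bigr => k _; case: (KJ k) => -[_ + _ _] _; exact.
  - move=> c f Ef; rewrite /J mulrCA; congr (_ * _); rewrite mulr_sumr.
    by apply: eq_bigr => k _; case: (KJ k) => -[_ _ + _] _; exact.
  - move=> f Ef f0; rewrite /J mulr_ge0 ?invr_ge0//; apply: sumr_ge0 => k _.
    by case: (KJ k) => -[_ _ _ +] _; exact.
  - move=> B mB; rewrite /J (eq_bigr (fun=> mass nu B)); last first.
      by move=> k _; case: (KJ k) => _; exact.
    by rewrite sumr_const card_ord -[mass nu B *+ _]mulr_natl mulrA mulVf ?mul1r.
have [U [UU ooU]] := @ultraFilterLemma nat \oo _.
have UJ : \forall n \near U, joining_functional nu (J n) by exact: nearW.
have [|mu mujoin _] := invariant_functional_joining (ultralimit_joining UU UJ);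
  last by exists mu.
move=> f Ef; have EfF : E (f \o F) by exact: integrand_comp.
apply/eqP; rewrite -subr_eq0; apply/eqP.
have cv : J n (f \o F) - J n f @[n --> U] -->
    ultralimit U J (f \o F) - ultralimit U J f.
  exact: (cvgB (ultralimit_cvg UU UJ EfF) (ultralimit_cvg UU UJ Ef)).
have cv0 : J n (f \o F) - J n f @[n --> \oo] --> (0 : R).
  have [_ _ [M fM]] := Ef.
  have KM k : `|K k f| <= M.
    have algE := @integrand_algebra R X Y.
    have [meanK _] := KJ k.
    have EM c : E (cst c) by exact: (algebra_cst algE).
    rewrite ler_norml -[X in X <= _ <= _](mean_cst algE meanK (- M)).
    rewrite -[X in _ <= _ <= X](mean_cst algE meanK M).
    rewrite (mean_le algE meanK (EM _) Ef) ?(mean_le algE meanK Ef (EM _))// => z;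
      by have := fM z; rewrite ler_norml => /andP[].
  have tele n : J n (f \o F) - J n f = n.+1%:R^-1 * (K n.+1 f - K 0%N f).
    rewrite /J -mulrBr; congr (_ * _).
    rewrite [X in X - _](eq_bigr (fun k : 'I_n.+1 => K k.+1 f)); last first.
      by move=> k _; exact: KS.
    rewrite -(big_mkord xpredT (fun k => K k.+1 f)).
    by rewrite -(big_mkord xpredT (fun k => K k f)) -sumrB telescope_sumr.
  apply/cvgr0Pnorm_le => e e0.
  have := @cvg_harmonic R; move/cvgr0Pnorm_le => /(_ (e / (2 * M + 1))).
  have M0 : 0 <= M by exact: le_trans (KM 0%N).
  have M10 : 0 < 2 * M + 1 by rewrite ltr_wpDl// mulr_ge0.
  rewrite divr_gt0// => /(_ isT); apply: filterS => n /= hn.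
  rewrite tele normrM -[leRHS](divfK (lt0r_neq0 M10)).
  apply: ler_pM => //; apply: le_trans (ler_normB _ _) _.
  have := KM n.+1; have := KM 0%N; lra.
have cvU : J n (f \o F) - J n f @[n --> U] --> (0 : R).
  exact: cvg_trans (cvg_app _ ooU) cv0.
by rewrite -(cvg_lim _ cv)// (cvg_lim _ cvU).
Qed.

End joinings.

(** * Lower semicontinuity of the cost *)

Section algebra_max.
Context d (T : measurableType d) (R : realType) (E : set (T -> R)).
Hypothesis algE : lattice_algebra E.

Lemma algebra_max f g : E f -> E g -> E (f \max g).
Proof.
move=> Ef Eg; have -> : f \max g = (f \+ g) \- (f \min g).
  by apply/funext => x /=; rewrite -(addr_max_min (f x)) addrK.
by apply: algebraB => //; [exact: algebraD|exact: algebra_min].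
Qed.

Lemma algebra_bigmax n (h : nat -> T -> R) : (forall k, E (h k)) ->
  E (fun x => \big[Num.max/0]_(k < n) h k x).
Proof.
elim: n h => [|n IH] h Eh.
  by under eq_fun do rewrite big_ord0; exact: algebra_cst.
under eq_fun do rewrite big_ord_recl/=.
apply: (algebra_max (Eh 0%N)).
exact: (IH (fun k => h (bump 0 k))).
Qed.

End algebra_max.

Section cost.
Context (R : realType) (X Y : ptopologicalType) (nu : probability (borel Y) R).
Variables (ell : X * Y -> R) (ellstar : Y -> R).
Hypotheses (coz : cozero_space R (X * Y)%type)
  (ell_lsc : lower_semicontinuous (EFin \o ell))
  (ellstar_L1 : nu.-integrable [set: borel Y] (EFin \o ellstar))
  (ell_le : forall z, `|ell z| <= ellstar z.2).

Let E := @integrands R X Y.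

Let mellstar : measurable_fun setT (ellstar : borel Y -> R).
Proof. by apply/measurable_EFinP; case/integrableP: ellstar_L1. Qed.

Let excess (z : X * Y) := ell z + ellstar z.2.

Let excess_ge0 z : 0 <= excess z.
Proof. by have := ell_le z; rewrite ler_norml /excess => /andP[]; lra. Qed.

(** As [ell + ellstar] is nonnegative, it is the supremum over the rationals [q]
    of the functions equal to [max (q + ellstar) 0] on the open set [ell > q] and
    to 0 elsewhere. Truncating the first factor at [m], replacing the indicator
    of the open set by a ramp, and taking the maximum over the first [m]
    rationals gives integrands. *)
Lemma excess_approximation : exists e : nat -> X * Y -> R,
  [/\ forall n, E (e n), forall n z, 0 <= e n z,
      forall n z, e n z <= e n.+1 z &
      forall z, e n z @[n --> \oo] --> excess z].
Proof.
pose q i : R := ratr (odflt 0 (unpickle i : option rat)).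
have openq i : open [set z | q i < ell z].
  have := (lower_semicontinuousP _).1 ell_lsc (q i).
  by congr open; apply/seteqP; split => z /=; rewrite lte_fin.
have /choice[h hP] := fun i => coz (openq i).
have h0 i z : 0 <= h i z by have [_ h01 _] := hP i; case/andP: (h01 z).
have hE i z : (0 < h i z) = (q i < ell z).
  have [_ _ /seteqP[sub sup]] := hP i.
  by apply/idP/idP => [/sup|/sub].
pose g i m (y : Y) := Num.min (Num.max (q i + ellstar y) 0) m%:R.
have g0 i m y : 0 <= g i m y by rewrite /g le_min ler0n le_max lexx orbT.
have gS i m y : g i m y <= g i m.+1 y.
  by rewrite /g le_min ge_min lexx/= ge_min ler_nat leqnSn orbT.
pose c m i (z : X * Y) := g i m z.2 * ramp (h i) m z.
have c0 m i z : 0 <= c m i z by rewrite mulr_ge0// ramp_ge0.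
have cS m i z : c m i z <= c m.+1 i z.
  exact: (ler_pM (g0 i m z.2) (ramp_ge0 (h0 i) m z) (gS i m z.2)
    (ramp_leS (h0 i) m z)).
have cex m i z : c m i z <= excess z.
  have [qz|zq] := ltP (q i) (ell z).
    apply: (@le_trans _ _ (g i m z.2)).
      by rewrite /c ler_piMr// ramp_le1.
    rewrite /g ge_min; apply/orP; left; rewrite ge_max excess_ge0 andbT.
    by rewrite /excess lerD2r ltW.
  rewrite /c ramp0 ?mulr0//; apply/eqP; rewrite eq_le h0 andbT leNgt hE.
  by rewrite -leNgt.
have Ec m i : E (c m i).
  apply: (algebraM (@integrand_algebra R X Y)).
    apply: (@integrand_snd R X Y (g i m)); last first.
      exists m%:R => y; rewrite ger0_norm// /g ge_min lexx orbT//.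
    have mq : measurable_fun setT (cst (q i) \+ ellstar : borel Y -> R).
      exact: measurable_funD.
    have mm : measurable_fun setT ((cst (q i) \+ ellstar) \max cst 0 : borel Y -> R).
      exact: measurable_maxr.
    exact: (measurable_minr mm (measurable_cst _)).
  have [ch h01 _] := hP i.
  apply: integrand_continuous; last first.
    by exists 1 => z; rewrite ger0_norm ?ramp_ge0// ramp_le1.
  move=> z; apply: (@continuous_min R (X * Y)%type); first exact: cvg_cst.
  by apply: cvgM; [exact: cvg_cst|exact: ch].
exists (fun m z => \big[Num.max/0]_(i < m) c m i z); split.
- move=> m; exact: (algebra_bigmax (@integrand_algebra R X Y) m (Ec m)).
- by move=> m z; exact: bigmax_ge_id.
- move=> m z; apply: bigmax_le; first exact: bigmax_ge_id.
  move=> i _; apply: (le_trans (cS m i z)).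
  exact: (@le_bigmax _ _ _ 0 (fun k : 'I_m.+1 => c m.+1 k z) (widen_ord (leqnSn m) i)).
- move=> z; apply/cvgrPdist_le => e e0.
  have [r /andP[rz zr]] : exists r : rat, ell z - e < ratr r < ell z.
    have [|r] := @rat_in_itvoo R (ell z - e) (ell z); first by lra.
    by rewrite in_itv/=; exists r.
  pose i := pickle r.
  have qi : q i = ratr r by rewrite /q pickleK.
  have [N hN] : exists n, forall m, (n <= m)%N -> ramp (h i) m z = 1.
    by apply: ramp1; rewrite hE qi.
  near=> m.
  have mi : (i < m)%N by near: m; exact: nbhs_infty_gt.
  have mN : (N <= m)%N by near: m; exact: nbhs_infty_ge.
  have mv : excess z <= m%:R by near: m; exact: nbhs_infty_ger.
  have le1 : \big[Num.max/0]_(i < m) c m i z <= excess z.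
    by apply: bigmax_le => // k _; exact: cex.
  have le2 : excess z - e <= \big[Num.max/0]_(i < m) c m i z.
    apply: le_trans (@le_bigmax _ _ _ 0 (fun k : 'I_m => c m k z) (Ordinal mi)).
    rewrite /c/= hN// mulr1 /g le_min le_max qi.
    by rewrite /excess in mv *; apply/andP; split; [apply/orP; left|]; lra.
  by rewrite ger0_norm; lra.
Unshelve. all: by end_near. Qed.

Lemma measurable_cost : measurable_fun setT (ell : borel (X * Y)%type -> R).
Proof.
have [e [Ee _ _ ecv]] := excess_approximation.
have mex : measurable_fun setT (excess : borel (X * Y)%type -> R).
  apply: (@measurable_fun_cvg _ (borel (X * Y)%type) R setT e excess) => [n|z _];
    last exact: ecv.
  exact: (integrand_measurable (Ee n)).
rewrite (_ : ell = excess \- (ellstar \o snd)); last first.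
  by apply/funext => z; rewrite /= /excess addrK.
apply: measurable_funB => //; apply: (measurableT_comp mellstar).
exact: (continuous_borel (@continuous_snd X Y)).
Qed.

Section marginal.
Variable la : probability (borel (X * Y)%type) R.
Hypothesis marg : forall B : set (borel Y), measurable B ->
  la (snd @^-1` B) = nu B.

Let msnd : measurable_fun setT (snd : borel (X * Y)%type -> borel Y).
Proof. exact: (continuous_borel (@continuous_snd X Y)). Qed.

Let ellstar_ge0 y : 0 <= ellstar y.
Proof. exact: le_trans (ell_le (point, y)). Qed.

Lemma integral_ellstar : (\int[la]_z (ellstar z.2)%:E = \int[nu]_y (ellstar y)%:E)%E.
Proof.
apply/esym; apply: (@ge0_integral_image _ _ _ _ _ la nu snd (EFin \o ellstar)) => //.
- by move=> B mB; rewrite marg.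
- exact/measurable_EFinP.
Qed.

Lemma integrable_ellstar : la.-integrable setT (fun z => (ellstar z.2)%:E).
Proof.
apply/integrableP; split; first exact/measurable_EFinP/(measurableT_comp mellstar).
under eq_integral do rewrite gee0_abs ?lee_fin//.
rewrite integral_ellstar; have /integrableP[_] := ellstar_L1.
by under eq_integral do rewrite gee0_abs ?lee_fin//.
Qed.

Lemma integrable_cost : la.-integrable setT (EFin \o ell).
Proof.
apply: (le_integrable measurableT _ _ integrable_ellstar).
  by apply/measurable_EFinP; exact: measurable_cost.
by move=> z _; rewrite /= lee_fin [leRHS]ger0_norm.
Qed.

Lemma integral_excess :
  (\int[la]_z (excess z)%:E =
   \int[la]_z (ell z)%:E + \int[nu]_y (ellstar y)%:E)%E.
Proof.
rewrite -integral_ellstar -integralD//; last exact: integrable_ellstar.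
exact: integrable_cost.
Qed.

Lemma cost_fin_num : (\int[la]_z (ell z)%:E)%E \is a fin_num.
Proof. exact: integrable_fin_num integrable_cost. Qed.

Lemma cost_ge : (- (\int[nu]_y (ellstar y)%:E) <= \int[la]_z (ell z)%:E)%E.
Proof.
have fin : (\int[nu]_y (ellstar y)%:E)%E \is a fin_num.
  exact: integrable_fin_num ellstar_L1.
rewrite -sub0e leeBlDr// -integral_excess.
by apply: integral_ge0 => z _; rewrite lee_fin.
Qed.

End marginal.

(** Adding [ellstar] shifts the cost by a constant on the measures with marginal
    [nu], and the integral of [ell + ellstar] is a supremum of integrals of
    integrands, which converge along [U]. *)
Lemma cost_lower_semicontinuous (I : Type) (U : set_system I)
    (la : I -> probability (borel (X * Y)%type) R)
    (mu : probability (borel (X * Y)%type) R) (c : R) : ProperFilter U ->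
  (\forall i \near U, forall B : set (borel Y), measurable B ->
    la i (snd @^-1` B) = nu B) ->
  (forall B : set (borel Y), measurable B -> mu (snd @^-1` B) = nu B) ->
  (forall f, E f -> \int[la i]_z f z @[i --> U] --> \int[mu]_z f z) ->
  (\forall i \near U, \int[la i]_z (ell z)%:E <= c%:E)%E ->
  (\int[mu]_z (ell z)%:E <= c%:E)%E.
Proof.
move=> PU Umarg marg Ucv Uc.
have fin : (\int[nu]_y (ellstar y)%:E)%E \is a fin_num.
  exact: integrable_fin_num ellstar_L1.
rewrite -(leeD2rE _ _ fin) -integral_excess//.
have [e [Ee e0 eS ecv]] := excess_approximation.
have algE := @integrand_algebra R X Y.
have inte (m : probability (borel (X * Y)%type) R) n :
    m.-integrable setT (EFin \o e n).
  have [me _ [M eM]] := Ee n; exact: (bounded_integrable m me eM).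
have me n : measurable_fun setT (e n : borel (X * Y)%type -> R) by case: (Ee n).
have ele n z : e n z <= excess z.
  rewrite -(cvg_lim _ (ecv z))//; apply: nondecreasing_cvgn_le.
    by apply/nondecreasing_seqP => m; exact: eS.
  exact: cvgP (ecv z).
apply: (@le_integral_limit _ _ _ mu e excess) => // n.
have -> : (\int[mu]_z (e n z)%:E = (\int[mu]_z e n z)%:E)%E.
  by rewrite /Rintegral fineK//; exact: integrable_fin_num (inte mu n).
rewrite -(fineK fin) -EFinD lee_fin.
have := Ucv _ (Ee n); set v := \int[mu]_z e n z => cv.
rewrite -(cvg_lim _ cv)//; apply: limr_le; first exact: cvgP cv.
near=> i; rewrite -lee_fin EFinD [X in (_ <= _ + X)%E]fineK// /Rintegral fineK;
  last exact: integrable_fin_num (inte (la i) n).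
have margi : forall B : set (borel Y), measurable B -> la i (snd @^-1` B) = nu B.
  by near: i.
have ci : (\int[la i]_z (ell z)%:E <= c%:E)%E by near: i.
apply: (@le_trans _ _ (\int[la i]_z (excess z)%:E)%E).
  apply: ge0_le_integral => //.
  - by move=> z _; rewrite lee_fin.
  - exact/measurable_EFinP.
  - apply/measurable_EFinP; apply: measurable_funD; first exact: measurable_cost.
    apply: (measurableT_comp mellstar).
    exact: (continuous_borel (@continuous_snd X Y)).
  - by move=> z _; rewrite lee_fin.
by rewrite integral_excess// leeD2r.
Unshelve. all: by end_near. Qed.

End cost.

(** * The set of optimal joinings *)

Section mixtures.
Context d (T : measurableType d) (R : realType).
Implicit Types (mu la : probability T R) (t : {i01 R}).

Lemma mixtureE t mu1 mu2 A : mixture t mu1 mu2 A =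
  (t%:num%:E * mu1 A + (1 - t%:num)%:E * mu2 A)%E.
Proof. by rewrite /mixture measure_addE. Qed.

Lemma mass_mixture t mu1 mu2 A : measurable A ->
  mass (mixture t mu1 mu2) A = t%:num * mass mu1 A + (1 - t%:num) * mass mu2 A.
Proof.
by move=> mA; rewrite {1}/mass [X in fine X]mixtureE (massE mu1)// (massE mu2).
Qed.

Lemma ge0_integral_mixture t mu1 mu2 (f : T -> \bar R) :
  measurable_fun setT f -> (forall x, 0 <= f x)%E ->
  (\int[mixture t mu1 mu2]_x f x =
   t%:num%:E * \int[mu1]_x f x + (1 - t%:num)%:E * \int[mu2]_x f x)%E.
Proof.
move=> mf f0; rewrite ge0_integral_measure_add//.
by rewrite !ge0_integral_mscale.
Qed.

Lemma conditional_probability la A : measurable A -> 0 < mass la A ->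
  exists mu, forall B, mu B = ((mass la A)^-1%:E * la (B `&` A))%E.
Proof.
move=> mA A0; have A0' : 0 <= (mass la A)^-1 by rewrite invr_ge0 ltW.
pose q := mscale (NngNum A0') (mrestr la mA).
have qT : q setT = 1%E.
  by rewrite /q /mscale/= /mrestr setTI massE// -EFinM mulVf ?gt_eqF.
pose p : probability T R := HB.pack q (Measure_isProbability.Build _ _ _ q qT).
by exists p.
Qed.

End mixtures.

Lemma cvg_initial (S : choiceType) (T : topologicalType) (f : S -> T)
    (F : set_system S) (s : S) : Filter F -> f @ F --> f s ->
  F --> (s : initial_topology f).
Proof.
move=> FF cvF A [_ [[B oB <-] Bs BA]]; apply: filterS BA _; apply: cvF.
exact: open_nbhs_nbhs.
Qed.

Section optimal_joinings.
Context (R : realType) (X Y : ptopologicalType).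
Variables (S : X -> X) (T : Y -> Y) (nu : probability (borel Y) R).
Variables (ell : X * Y -> R) (ellstar : Y -> R).
Hypotheses (compactX : compact [set: X]) (X2 : @second_countable X)
  (coz : cozero_space R (X * Y)%type) (cS : continuous S)
  (mT : measurable_fun [set: borel Y] (T : borel Y -> borel Y))
  (T_nu_ergodic : ergodic nu T)
  (ell_lsc : lower_semicontinuous (EFin \o ell))
  (ellstar_L1 : nu.-integrable [set: borel Y] (EFin \o ellstar))
  (ell_le : forall z, `|ell z| <= ellstar z.2).

Let F : borel (X * Y)%type -> borel (X * Y)%type := prod_map S T.
Let L := min_cost S T nu ell.
Let cost (la : probability (borel (X * Y)%type) R) := (\int[la]_z (ell z)%:E)%E.

Let cost_fin la : joinings S T nu la -> cost la \is a fin_num.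
Proof.
by move=> [_ marg]; exact: (cost_fin_num coz ell_lsc ellstar_L1 ell_le marg).
Qed.

Lemma min_cost_le la : joinings S T nu la -> (L <= cost la)%E.
Proof. by move=> Jla; apply: ereal_inf_lbound; exists la. Qed.

Lemma min_cost_fin_num : L \is a fin_num.
Proof.
have [la Jla] := joinings_nonempty compactX X2 coz cS mT T_nu_ergodic.
rewrite fin_numElt; apply/andP; split.
  have fin : (- (\int[nu]_y (ellstar y)%:E))%E \is a fin_num.
    by rewrite fin_numN; exact: integrable_fin_num ellstar_L1.
  apply: (@lt_le_trans _ _ (- (\int[nu]_y (ellstar y)%:E))%E).
    by rewrite ltNye_eq fin.
  apply: le_ereal_inf_tmp => _ [mu [_ marg] <-].
  exact: (cost_ge coz ell_lsc ellstar_L1 ell_le marg).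
by apply: le_lt_trans (min_cost_le Jla) _; rewrite ltey_eq cost_fin.
Qed.

(** Covers both a minimizing sequence, which gives existence, and an ultrafilter
    of optimal joinings, which gives compactness. *)
Lemma ultralimit_optimal (I : Type) (U : set_system I)
    (la : I -> probability (borel (X * Y)%type) R) : UltraFilter U ->
  (\forall i \near U, joinings S T nu (la i)) ->
  (forall c : R, (L < c%:E)%E -> \forall i \near U, (cost (la i) <= c%:E)%E) ->
  exists2 mu, optimal_joinings S T nu ell mu &
    forall f, @integrands R X Y f ->
      \int[la i]_z f z @[i --> U] --> \int[mu]_z f z.
Proof.
move=> UU Ula Uc.
have [mu Jmu mucv] := joinings_ultralimit compactX X2 coz cS mT UU Ula.
exists mu => //; split => //; apply/eqP; rewrite eq_le min_cost_le// andbT.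
apply/lee_addgt0Pr => e e0; rewrite -/L -(fineK min_cost_fin_num) -EFinD.
apply: (cost_lower_semicontinuous coz ell_lsc ellstar_L1 ell_le
  (ultra_proper (UltraFilter := UU)) _ Jmu.2 mucv).
  by apply: filterS Ula => i [].
by apply: Uc; rewrite -[X in (X < _)%E](fineK min_cost_fin_num) lte_fin ltrDl.
Qed.

Lemma optimal_nonempty : optimal_joinings S T nu ell !=set0.
Proof.
have /choice[la laP] : forall n : nat, exists la, joinings S T nu la /\
    (cost la <= L + (n.+1%:R^-1)%:E)%E.
  move=> n; have n0 : 0 < n.+1%:R^-1 :> R by rewrite invr_gt0.
  have [_ [la Jla <-] /ltW ?] := lb_ereal_inf_adherent n0 min_cost_fin_num.
  by exists la.
have [U [UU ooU]] := @ultraFilterLemma nat \oo _.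
have [||mu Jmu _] := @ultralimit_optimal nat U la UU; last by exists mu.
  by apply: nearW => n; have [] := laP n.
move=> c Lc; apply: ooU.
have d0 : 0 < c - fine L.
  by rewrite subr_gt0 -lte_fin fineK// min_cost_fin_num.
have := @cvg_harmonic R; move/cvgr0Pnorm_le => /(_ _ d0).
apply: filterS => n /= hn; apply: le_trans (laP n).2 _.
rewrite -(fineK min_cost_fin_num) -EFinD lee_fin.
by rewrite -lerBrDl; exact: le_trans (ler_norm _) hn.
Qed.

Lemma optimal_compact :
  compact (optimal_joinings S T nu ell : set (weak_probability R (X * Y)%type)).
Proof.
rewrite compact_ultra => U UU UJ.
have [||mu Jmu mucv] := @ultralimit_optimal _ U id UU.
- by apply: filterS UJ => la [].
- by move=> c Lc; apply: filterS UJ => la [_]; rewrite /cost => ->; exact: ltW.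
exists mu; split => //=.
apply: (cvg_initial (f := @integrals R (X * Y)%type)).
apply/cvg_sup => -[f [cf bf]]; apply: cvg_initial => /=.
apply: mucv; apply: integrand_continuous => //.
by have [M [_ fM]] := bf; exists (M + 1) => z; apply: fM => //; rewrite ltrDl.
Qed.

Lemma joinings_convex : convex_family (joinings S T nu).
Proof.
move=> t mu1 mu2 [inv1 marg1] [inv2 marg2]; split => [A mA|B mB].
  by rewrite /pushforward [LHS]mixtureE [RHS]mixtureE -(inv1 _ mA) -(inv2 _ mA).
rewrite /pushforward [LHS]mixtureE.
rewrite [X in (_ * X + _)%E](marg1 _ mB) [X in (_ + _ * X)%E](marg2 _ mB).
rewrite -(fineK (fin_num_measure nu _ mB)) -!EFinM -EFinD -mulrDl.
by rewrite addrC subrK mul1r.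
Qed.

Lemma cost_mixture t mu1 mu2 : joinings S T nu mu1 -> joinings S T nu mu2 ->
  fine (cost (mixture t mu1 mu2)) =
    t%:num * fine (cost mu1) + (1 - t%:num) * fine (cost mu2).
Proof.
move=> J1 J2; have J := joinings_convex t J1 J2.
have fin : (\int[nu]_y (ellstar y)%:E)%E \is a fin_num.
  exact: integrable_fin_num ellstar_L1.
have [_ m0] := J; have [_ m1] := J1; have [_ m2] := J2.
have ex (la : probability (borel (X * Y)%type) R) : joinings S T nu la ->
    (\int[la]_z (ell z + ellstar z.2)%:E =
     (fine (cost la) + fine (\int[nu]_y (ellstar y)%:E)%E)%:E)%E.
  move=> Jla; have [_ marg] := Jla.
  rewrite (integral_excess coz ell_lsc ellstar_L1 ell_le marg).
  by rewrite EFinD !fineK// cost_fin.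
have := ex _ J; rewrite ge0_integral_mixture; last 2 first.
- apply/measurable_EFinP; apply: measurable_funD.
    exact: (measurable_cost coz ell_lsc ellstar_L1 ell_le).
  have mes : measurable_fun setT (ellstar : borel Y -> R).
    by apply/measurable_EFinP; case/integrableP: ellstar_L1.
  apply: (measurableT_comp mes).
  exact: (continuous_borel (@continuous_snd X Y)).
- by move=> z; rewrite lee_fin; have := ell_le z; rewrite ler_norml => /andP[]; lra.
rewrite !ex// -!EFinM -EFinD => -[]; lra.
Qed.

Lemma optimal_convex : convex_family (optimal_joinings S T nu ell).
Proof.
move=> t mu1 mu2 [J1 c1] [J2 c2].
have J := joinings_convex t J1 J2; split => //.
rewrite -/(cost _) -(fineK (cost_fin J)) cost_mixture//.
rewrite /cost c1 c2 -/L -mulrDl addrC subrK mul1r.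
exact: (fineK min_cost_fin_num).
Qed.

(** The [Y]-marginal of the conditional measure is [T]-invariant and dominated by
    [nu], so it is [nu] by ergodicity. *)
Lemma conditional_joining la A : joinings S T nu la -> measurable A ->
  F @^-1` A = A -> 0 < mass la A ->
  exists2 mu, joinings S T nu mu & forall B, measurable B ->
    mass mu B = (mass la A)^-1 * mass la (B `&` A).
Proof.
move=> [inv marg] mA FA A0.
have [mu muE] := conditional_probability mA A0.
have mF := measurable_joint X2 cS mT.
have msnd := @measurable_second X Y.
have invmu : Defs.invariant mu F.
  move=> B mB; rewrite /pushforward !muE; congr (_ * _)%E.
  by rewrite -[in LHS]FA -preimage_setI -[RHS]inv//; exact: measurableI.
exists mu; last first.
  by move=> B mB; rewrite {1}/mass muE massE//; exact: measurableI.
split => //.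
have [p pE] := image_probability mu msnd.
suff pnu : same_measure p nu by move=> B mB; rewrite /pushforward -pE pnu.
apply: (ergodic_unique mT T_nu_ergodic) => B mB.
  rewrite /pushforward !pE -[RHS]invmu//.
  exact: (preimage_borel msnd mB).
rewrite pE muE -marg// /pushforward => nuB.
have /(subset_measure0 _ _ (@subIsetl _ _ A)) -> // : la (snd @^-1` B) = 0 by [].
- by rewrite mule0.
- by apply: measurableI => //; exact: (preimage_borel msnd mB).
- exact: (preimage_borel msnd mB).
Qed.

Lemma ergodic_extreme la : optimal_joinings S T nu ell la -> ergodic la F ->
  extreme_point (optimal_joinings S T nu ell) la.
Proof.
move=> Jla erg; split => // t mu1 mu2 /andP[t0 t1] [[inv1 _] _] [[inv2 _] _] mix.
have mF := measurable_joint X2 cS mT.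
have null A : measurable A -> la A = 0 -> mu1 A = 0 /\ mu2 A = 0.
  move=> mA laA.
  have : mass la A = t%:num * mass mu1 A + (1 - t%:num) * mass mu2 A.
    by rewrite -mass_mixture// /mass mix.
  have m1 : 0 <= mass mu1 A by rewrite fine_ge0.
  have m2 : 0 <= mass mu2 A by rewrite fine_ge0.
  rewrite {1}/mass laA/= => e.
  have u0 : 0 < 1 - t%:num by rewrite subr_gt0.
  have p1 : 0 <= t%:num * mass mu1 A by rewrite mulr_ge0// ltW.
  have p2 : 0 <= (1 - t%:num) * mass mu2 A by rewrite mulr_ge0// ltW.
  have /eqP : t%:num * mass mu1 A = 0 by lra.
  have /eqP : (1 - t%:num) * mass mu2 A = 0 by lra.
  rewrite !mulf_eq0 (gt_eqF u0) (gt_eqF t0)/= => /eqP e2 /eqP e1.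
  by rewrite (massE mu1)// (massE mu2)// e1 e2.
split; apply: (ergodic_unique mF erg) => // A mA /null[]//.
Qed.

(** An invariant set of intermediate measure splits [la] into its conditional
    measures. These are again joinings, because [nu] is ergodic, and optimal,
    because their costs average to the minimum. *)
Lemma extreme_ergodic la : optimal_joinings S T nu ell la ->
  extreme_point (optimal_joinings S T nu ell) la -> ergodic la F.
Proof.
move=> [Jla cla] [_ ext]; split; first by case: Jla.
move=> A mA FA; apply: contrapT => /not_orP[A0 A1].
have mAC : measurable (~` A) by exact: measurableC.
have m0 : 0 < mass la A.
  rewrite lt_neqAle fine_ge0// andbT eq_sym; apply/eqP => e.
  by apply: A0; rewrite massE// e.
have m1 : mass la A < 1.
  rewrite lt_neqAle; apply/andP; split.
    by apply/eqP => e; apply: A1; rewrite massE// e.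
  by rewrite -lee_fin -massE// probability_le1.
have mC : mass la (~` A) = 1 - mass la A by exact: massC.
have mC0 : 0 < mass la (~` A) by rewrite mC subr_gt0.
have FAC : F @^-1` (~` A) = ~` A by rewrite -preimage_setC FA.
have [mu1 J1 mu1E] := conditional_joining Jla mA FA m0.
have [mu2 J2 mu2E] := conditional_joining Jla mAC FAC mC0.
pose t : {i01 R} := Itv01 (ltW m0) (ltW m1).
have mix : same_measure la (mixture t mu1 mu2).
  move=> B mB; rewrite (massE la)// (massE (mixture _ _ _))//.
  rewrite mass_mixture//= mu1E// mu2E// -mC !mulrA !divff ?gt_eqF// !mul1r.
  by rewrite -setDE -mass_split.
have cmix : fine (cost la) = fine (cost (mixture t mu1 mu2)).
  by congr fine; apply: eq_measure_integral => B mB _; exact: mix.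
have le1 : fine L <= fine (cost mu1).
  by rewrite fine_le ?min_cost_fin_num ?cost_fin// min_cost_le.
have le2 : fine L <= fine (cost mu2).
  by rewrite fine_le ?min_cost_fin_num ?cost_fin// min_cost_le.
have := cmix; rewrite cost_mixture// {1}/cost cla -/L /= -mC => e.
have p1 : 0 <= mass la A * (fine (cost mu1) - fine L).
  by rewrite mulr_ge0 ?subr_ge0// ltW.
have p2 : 0 <= mass la (~` A) * (fine (cost mu2) - fine L).
  by rewrite mulr_ge0 ?subr_ge0// ltW.
have /eqP : mass la A * (fine (cost mu1) - fine L) = 0.
  move: e p1 p2; rewrite mC; lra.
have /eqP : mass la (~` A) * (fine (cost mu2) - fine L) = 0.
  move: e p1 p2; rewrite mC; lra.
rewrite !mulf_eq0 (gt_eqF m0) (gt_eqF mC0)/= !subr_eq0 => /eqP e2 /eqP e1.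
have O1 : optimal_joinings S T nu ell mu1.
  by split => //; rewrite -/(cost _) -(fineK (cost_fin J1)) e1 fineK// min_cost_fin_num.
have O2 : optimal_joinings S T nu ell mu2.
  by split => //; rewrite -/(cost _) -(fineK (cost_fin J2)) e2 fineK// min_cost_fin_num.
have t01 : 0 < t%:num < 1 by rewrite /= m0 m1.
have [mu1la _] := ext t mu1 mu2 t01 O1 O2 mix.
have : mass mu1 A = mass la A by rewrite /mass mu1la.
rewrite mu1E// setIid mulVf ?gt_eqF// => e3.
by have := m1; rewrite -e3 ltxx.
Qed.

End optimal_joinings.

Lemma polish_product_cozero (R : realType) (X : pmetricType R)
    (Y : ptopologicalType) : polish_space R Y -> cozero_space R (X * Y)%type.
Proof.
move=> [_ [M [f [g [fK _ cf cg]]]]].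
have cpair (A B : topologicalType) (h : A -> B) : continuous h ->
    continuous (fun z : X * A => (z.1, h z.2)).
  move=> ch z; apply: cvg_pair; first exact: cvg_fst.
  by apply: continuous_comp; [exact: cvg_snd|exact: ch].
apply: (@homeo_cozero R _ (X * M)%type (fun z => (z.1, f z.2))
  (fun z => (z.1, g z.2))).
- by move=> [x y] /=; rewrite fK.
- exact: cpair.
- exact: cpair.
- exact: (@pseudometric_cozero R (X * M)%type).
Qed.

Theorem theorem2p5 (R : realType) (X : pmetricType R) (Y : ptopologicalType)
    (S : X -> X) (T : Y -> Y) (nu : probability (borel Y) R)
    (ell : X * Y -> R) (ellstar : Y -> R)
    (polishY : polish_space R Y)
    (mT : measurable_fun [set: borel Y] (T : borel Y -> borel Y))
    (T_nu_ergodic : ergodic nu T)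
    (compactX : compact [set: X])
    (S_continuous : continuous S)
    (ell_lsc : lower_semicontinuous (EFin \o ell))
    (ellstar_L1 : nu.-integrable [set: borel Y] (EFin \o ellstar))
    (ell_le : forall y : Y,
      (ereal_sup [set `|ell (x, y)|%:E | x in [set: X]] <= (ellstar y)%:E)%E) :
  let Jmin := optimal_joinings S T nu ell in
  [/\ Jmin !=set0,
      convex_family Jmin,
      compact (Jmin : set (weak_probability R (X * Y)%type)) &
      forall la, Jmin la ->
        (extreme_point Jmin la <-> ergodic la (prod_map S T))].
Proof.
have X2 : @second_countable X by exact: compact_second_countable.
have coz : cozero_space R (X * Y)%type by exact: polish_product_cozero.
have ell_bound z : `|ell z| <= ellstar z.2.
  rewrite -lee_fin; apply: le_trans (ell_le z.2).
  by apply: ereal_sup_ubound; exists z.1 => //; rewrite -surjective_pairing.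
move=> Jmin; split.
- exact: (optimal_nonempty compactX X2 coz S_continuous mT T_nu_ergodic
    ell_lsc ellstar_L1 ell_bound).
- exact: (optimal_convex compactX X2 coz S_continuous mT T_nu_ergodic
    ell_lsc ellstar_L1 ell_bound).
- exact: (optimal_compact compactX X2 coz S_continuous mT T_nu_ergodic
    ell_lsc ellstar_L1 ell_bound).
- move=> la Jla; split.
  + exact: (extreme_ergodic compactX X2 coz S_continuous mT T_nu_ergodic
      ell_lsc ellstar_L1 ell_bound Jla).
  + exact: (ergodic_extreme X2 S_continuous mT Jla).
Qed.
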